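(* Let $n\ge 1$. There is no nearly Kenmotsu hypersurface in a nearly Kähler manifold. That is, if $(N,J,G)$ is a nearly Kähler manifold of dimension $2n+2$ and $M\subset N$ is a $(2n+1)$-dimensional Riemannian hypersurface with unit normal vector field $\nu$, induced metric $g$ and induced almost contact metric structure $(\phi,\xi,\eta,g)$ determined by $JX=\phi X+\eta(X)\nu$ (for $X$ tangent to $M$) and $J\nu=-\xi$, then $(M,\phi,\xi,\eta,g)$ is not a nearly Kenmotsu manifold.
   Context: All objects are smooth ($C^\infty$) and manifolds are (nonempty and) connected. An almost contact metric structure on a $(2n+1)$-dimensional manifold $M$ is a quadruple $(\phi,\xi,\eta,g)$ consisting of a $(1,1)$-tensor field $\phi$, a vector field $\xi$, a one-form $\eta$ and a Riemannian metric $g$ such that $\phi^2=-\mathrm{Id}+\eta\otimes\xi$, $\eta(\xi)=1$ and $g(\phi X,\phi Y)=g(X,Y)-\eta(X)\eta(Y)$ for all vector fields $X,Y$; then $\eta(X)=g(X,\xi)$, $\phi\xi=0$, $\eta\circ\phi=0$ and $g(X,\phi Y)+g(\phi X,Y)=0$. Let $\nabla$ be the Levi-Civita connection of $g$. The almost contact metric manifold $(M,\phi,\xi,\eta,g)$ is called nearly Kenmotsu if $(\nabla_X\phi)Y+(\nabla_Y\phi)X=-\eta(Y)\phi X-\eta(X)\phi Y$ for all vector fields $X,Y$. An almost Hermitian manifold $(N,J,G)$ with Levi-Civita connection $\bar\nabla$ of $G$ is called nearly Kähler if $(\bar\nabla_XJ)Y+(\bar\nabla_YJ)X=0$ for all vector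 fields $X,Y$. A Riemannian hypersurface $(M,g)\subset(N,G)$ with unit normal field $\nu$ carries the almost contact metric structure $(\phi,\xi,\eta,g)$ defined by $JX=\phi X+\eta(X)\nu$ and $J\nu=-\xi$. *)

(* Defs.v *)
From HB Require Import structures.
From mathcomp Require Import all_boot all_order all_algebra.
From mathcomp Require Import all_classical all_reals all_analysis.
Set Implicit Arguments.
Unset Strict Implicit.
Unset Printing Implicit Defensive.
Import Order.TTheory GRing.Theory Num.Theory numFieldNormedType.Exports.
Local Open Scope classical_set_scope.
Local Open Scope ring_scope.

(* C^oo on an open set U of a finite-dimensional space: every iterated
   directional derivative is (Frechet) differentiable on U. *)
Definition smooth_on (R : realType) (V W : normedModType R)
    (U : set V) (f : V -> W) : Prop :=
  forall (vs : seq V) (x : V), U x ->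
    differentiable (foldr (fun v (h : V -> W) => 'D_v h : V -> W) f vs) x.

(* Values of chart_map and chart_inv outside chart_dom and its image are
   irrelevant. *)
Record chart (R : realType) (m : nat) (T : topologicalType) := Chart {
  chart_dom : set T;
  chart_map :> T -> 'rV[R]_m;
  chart_inv : 'rV[R]_m -> T;
  chart_dom_open : open chart_dom;
  chart_im_open : open (chart_map @` chart_dom);
  chart_mapK : forall p, chart_dom p -> chart_inv (chart_map p) = p;
  chart_map_cont : {within chart_dom, continuous chart_map};
  chart_inv_cont : {within chart_map @` chart_dom, continuous chart_inv}
}.

(* Each point comes with a preferred chart around it, which serves to identify
   the tangent space at that point with 'rV[R]_m. *)
Record manifold (R : realType) (m : nat) := Manifold {
  manifold_sort :> topologicalType;
  manifold_hausdorff : hausdorff_space manifold_sort;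
  manifold_countable : second_countable (T := manifold_sort);
  manifold_nonempty : [set: manifold_sort] !=set0;
  manifold_connected : connected [set: manifold_sort];
  atlas : set (chart R m manifold_sort);
  chart_at : manifold_sort -> chart R m manifold_sort;
  chart_at_atlas : forall p, atlas (chart_at p);
  chart_at_dom : forall p, chart_dom (chart_at p) p;
  transition_smooth : forall c d, atlas c -> atlas d ->
    smooth_on (c @` (chart_dom c `&` chart_dom d)) (d \o chart_inv c)
}.

(* Tangent vectors at p are row vectors, the coordinates with respect to
   chart_at p.  Thus a vector field is a map M -> 'rV[R]_m; a (1,1)-tensor
   field A : M -> 'M[R]_m sends v at p to v *m A p; a one-form is a map
   M -> 'cV[R]_m evaluated by ev; a bilinear form is a map M -> 'M[R]_m
   evaluated by pairing. *)
Definition ev (R : realType) (m : nat) (a : 'cV[R]_m) (v : 'rV[R]_m) : R :=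
  (v *m a) 0 0.

Definition pairing (R : realType) (m : nat) (g : 'M[R]_m) (u v : 'rV[R]_m) : R :=
  (u *m g *m v^T) 0 0.

(* Coordinates in the chart c of the tangent vector v at p. *)
Definition coords (R : realType) (m : nat) (M : manifold R m)
    (c : chart R m M) (p : M) (v : 'rV[R]_m) : 'rV[R]_m :=
  'd (c \o chart_inv (chart_at p)) (chart_at p p) v.

(* Tangent vector at chart_inv c x whose coordinates in the chart c are v. *)
Definition of_coords (R : realType) (m : nat) (M : manifold R m)
    (c : chart R m M) (x v : 'rV[R]_m) : 'rV[R]_m :=
  'd (chart_at (chart_inv c x) \o chart_inv c) x v.

Definition smooth_fun (R : realType) (m : nat) (M : manifold R m)
    (f : M -> R) : Prop :=
  forall c, atlas c -> smooth_on (c @` chart_dom c) (f \o chart_inv c).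

Definition smooth_map (R : realType) (m k : nat)
    (M : manifold R m) (N : manifold R k) (F : M -> N) : Prop :=
  continuous F /\
  forall c d, atlas c -> atlas d ->
    smooth_on (c @` (chart_dom c `&` F @^-1` chart_dom d))
              (d \o F \o chart_inv c).

(* The differential T_p M -> T_(F p) N. *)
Definition differential (R : realType) (m k : nat)
    (M : manifold R m) (N : manifold R k) (F : M -> N)
    (p : M) (v : 'rV[R]_m) : 'rV[R]_k :=
  'd (chart_at (F p) \o F \o chart_inv (chart_at p)) (chart_at p p) v.

(* A vector field along F: the vector V p is tangent to N at F p. *)
Definition smooth_along (R : realType) (m k : nat)
    (M : manifold R m) (N : manifold R k) (F : M -> N)
    (V : M -> 'rV[R]_k) : Prop :=
  forall c d, atlas c -> atlas d ->
    smooth_on (c @` (chart_dom c `&` F @^-1` chart_dom d))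
      (fun x => coords d (F (chart_inv c x)) (V (chart_inv c x))).

Definition vf_coords (R : realType) (m : nat) (M : manifold R m)
    (c : chart R m M) (X : M -> 'rV[R]_m) (x : 'rV[R]_m) : 'rV[R]_m :=
  coords c (chart_inv c x) (X (chart_inv c x)).

Definition smooth_vf (R : realType) (m : nat) (M : manifold R m)
    (X : M -> 'rV[R]_m) : Prop :=
  forall c, atlas c -> smooth_on (c @` chart_dom c) (vf_coords c X).

Definition smooth_form (R : realType) (m : nat) (M : manifold R m)
    (a : M -> 'cV[R]_m) : Prop :=
  forall c v, atlas c ->
    smooth_on (c @` chart_dom c)
      (fun x => ev (a (chart_inv c x)) (of_coords c x v)).

Definition smooth_endo (R : realType) (m : nat) (M : manifold R m)
    (A : M -> 'M[R]_m) : Prop :=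
  forall c v, atlas c ->
    smooth_on (c @` chart_dom c)
      (fun x => coords c (chart_inv c x) (of_coords c x v *m A (chart_inv c x))).

Definition smooth_bilin (R : realType) (m : nat) (M : manifold R m)
    (g : M -> 'M[R]_m) : Prop :=
  forall c u v, atlas c ->
    smooth_on (c @` chart_dom c)
      (fun x => pairing (g (chart_inv c x)) (of_coords c x u) (of_coords c x v)).

Record riemannian_metric (R : realType) (m : nat) (M : manifold R m)
    (g : M -> 'M[R]_m) : Prop := RiemannianMetric {
  metric_smooth : smooth_bilin g;
  metric_sym : forall p u v, pairing (g p) u v = pairing (g p) v u;
  metric_pos : forall p v, v != 0 -> 0 < pairing (g p) v v
}.

(* X f *)
Definition dirderiv (R : realType) (m : nat) (M : manifold R m)
    (X : M -> 'rV[R]_m) (f : M -> R) (p : M) : R :=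
  'd (f \o chart_inv (chart_at p)) (chart_at p p) (X p).

(* [X, Y]^j = X^i d_i Y^j - Y^i d_i X^j, in the chart at p. *)
Definition lie_bracket (R : realType) (m : nat) (M : manifold R m)
    (X Y : M -> 'rV[R]_m) (p : M) : 'rV[R]_m :=
  let c := chart_at p in
  'd (vf_coords c Y) (c p) (X p) - 'd (vf_coords c X) (c p) (Y p).

(* nabla X Y stands for the covariant derivative of Y along X; only its values
   on smooth vector fields matter. *)
Record affine_connection (R : realType) (m : nat) (M : manifold R m)
    (nabla : (M -> 'rV[R]_m) -> (M -> 'rV[R]_m) -> M -> 'rV[R]_m) : Prop :=
  AffineConnection {
  conn_smooth : forall X Y, smooth_vf X -> smooth_vf Y -> smooth_vf (nabla X Y);
  connDl : forall X Y Z, smooth_vf X -> smooth_vf Y -> smooth_vf Z ->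
    forall p, nabla (fun q => X q + Y q) Z p = nabla X Z p + nabla Y Z p;
  connZl : forall f X Y, smooth_fun f -> smooth_vf X -> smooth_vf Y ->
    forall p, nabla (fun q => f q *: X q) Y p = f p *: nabla X Y p;
  connDr : forall X Y Z, smooth_vf X -> smooth_vf Y -> smooth_vf Z ->
    forall p, nabla X (fun q => Y q + Z q) p = nabla X Y p + nabla X Z p;
  conn_leibniz : forall f X Y, smooth_fun f -> smooth_vf X -> smooth_vf Y ->
    forall p, nabla X (fun q => f q *: Y q) p
              = dirderiv X f p *: Y p + f p *: nabla X Y p
}.

(* Existence and uniqueness (on smooth vector fields) of such a nabla is the
   fundamental theorem of Riemannian geometry, so that "exists nabla,
   levi_civita g nabla" below means "the Levi-Civita connection nabla of g". *)
Record levi_civita (R : realType) (m : nat) (M : manifold R m)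
    (g : M -> 'M[R]_m)
    (nabla : (M -> 'rV[R]_m) -> (M -> 'rV[R]_m) -> M -> 'rV[R]_m) : Prop :=
  LeviCivita {
  lc_connection : affine_connection nabla;
  lc_torsion_free : forall X Y, smooth_vf X -> smooth_vf Y ->
    forall p, nabla X Y p - nabla Y X p = lie_bracket X Y p;
  lc_metric : forall X Y Z, smooth_vf X -> smooth_vf Y -> smooth_vf Z ->
    forall p, dirderiv X (fun q => pairing (g q) (Y q) (Z q)) p
              = pairing (g p) (nabla X Y p) (Z p)
                + pairing (g p) (Y p) (nabla X Z p)
}.

(* (nabla_X A) Y = nabla_X (A Y) - A (nabla_X Y) *)
Definition cov_endo (R : realType) (m : nat) (M : manifold R m)
    (nabla : (M -> 'rV[R]_m) -> (M -> 'rV[R]_m) -> M -> 'rV[R]_m)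
    (A : M -> 'M[R]_m) (X Y : M -> 'rV[R]_m) (p : M) : 'rV[R]_m :=
  nabla X (fun q => Y q *m A q) p - nabla X Y p *m A p.

Record almost_contact_metric (R : realType) (n : nat) (M : manifold R (2 * n).+1)
    (phi : M -> 'M[R]_((2 * n).+1)) (xi : M -> 'rV[R]_((2 * n).+1))
    (eta : M -> 'cV[R]_((2 * n).+1)) (g : M -> 'M[R]_((2 * n).+1)) : Prop :=
  AlmostContactMetric {
  acm_phi_smooth : smooth_endo phi;
  acm_xi_smooth : smooth_vf xi;
  acm_eta_smooth : smooth_form eta;
  acm_metric : riemannian_metric g;
  acm_phi2 : forall p v, v *m phi p *m phi p = - v + ev (eta p) v *: xi p;
  acm_eta_xi : forall p, ev (eta p) (xi p) = 1;
  acm_compat : forall p u v,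
    pairing (g p) (u *m phi p) (v *m phi p)
    = pairing (g p) u v - ev (eta p) u * ev (eta p) v
}.

Definition nearly_kenmotsu (R : realType) (n : nat) (M : manifold R (2 * n).+1)
    (phi : M -> 'M[R]_((2 * n).+1)) (xi : M -> 'rV[R]_((2 * n).+1))
    (eta : M -> 'cV[R]_((2 * n).+1)) (g : M -> 'M[R]_((2 * n).+1)) : Prop :=
  almost_contact_metric phi xi eta g /\
  exists2 nabla, levi_civita g nabla &
    forall X Y, smooth_vf X -> smooth_vf Y -> forall p,
      cov_endo nabla phi X Y p + cov_endo nabla phi Y X p
      = - (ev (eta p) (Y p) *: (X p *m phi p))
        - ev (eta p) (X p) *: (Y p *m phi p).

Record almost_hermitian (R : realType) (k : nat) (N : manifold R k)
    (J G : N -> 'M[R]_k) : Prop := AlmostHermitian {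
  ah_J_smooth : smooth_endo J;
  ah_metric : riemannian_metric G;
  ah_J2 : forall p (v : 'rV[R]_k), v *m J p *m J p = - v;
  ah_compat : forall p u v,
    pairing (G p) (u *m J p) (v *m J p) = pairing (G p) u v
}.

Definition nearly_kahler (R : realType) (k : nat) (N : manifold R k)
    (J G : N -> 'M[R]_k) : Prop :=
  almost_hermitian J G /\
  exists2 nabla, levi_civita G nabla &
    forall X Y, smooth_vf X -> smooth_vf Y -> forall p,
      cov_endo nabla J X Y p + cov_endo nabla J Y X p = 0.

(* The submanifold M of N is given through its inclusion iota, an injective
   immersion; g is the induced metric. *)
Record riemannian_hypersurface (R : realType) (m : nat)
    (M : manifold R m) (N : manifold R m.+1) (iota : M -> N)
    (g : M -> 'M[R]_m) (G : N -> 'M[R]_(m.+1)) : Prop := RiemannianHypersurface {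
  hyp_inj : injective iota;
  hyp_smooth : smooth_map iota;
  hyp_immersion : forall p, injective (differential iota p);
  hyp_metric : forall p u v, pairing (g p) u v
    = pairing (G (iota p)) (differential iota p u) (differential iota p v)
}.

Record unit_normal (R : realType) (m : nat)
    (M : manifold R m) (N : manifold R m.+1) (iota : M -> N)
    (G : N -> 'M[R]_(m.+1)) (nu : M -> 'rV[R]_(m.+1)) : Prop := UnitNormal {
  normal_smooth : smooth_along iota nu;
  normal_unit : forall p, pairing (G (iota p)) (nu p) (nu p) = 1;
  normal_orth : forall p v,
    pairing (G (iota p)) (nu p) (differential iota p v) = 0
}.

(* J X = phi X + eta(X) nu for X tangent to M, and J nu = - xi. *)
Definition induced_structure (R : realType) (m : nat)
    (M : manifold R m) (N : manifold R m.+1) (iota : M -> N)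
    (J : N -> 'M[R]_(m.+1)) (nu : M -> 'rV[R]_(m.+1))
    (phi : M -> 'M[R]_m) (xi : M -> 'rV[R]_m) (eta : M -> 'cV[R]_m) : Prop :=
  (forall p v, differential iota p v *m J (iota p)
     = differential iota p (v *m phi p) + ev (eta p) v *: nu p) /\
  (forall p, nu p *m J (iota p) = - differential iota p (xi p)).

(* Main.v *)
(* Write h for the second fundamental form of M and (.)' for the differential of
   the inclusion.  In charts, g and the 2-form g(phi u, w) are the pullbacks of
   G and of G(J a, b).  Expressing the covariant derivatives of phi and J by
   derivatives of these forms and by Christoffel symbols of the first kind
   (Koszul formula), and using u'J = (phi u)' + eta(u) nu, the nearly Kaehler
   condition gives
     g((nabla_u phi) u, w) = eta(u) h(u, w) - eta(w) h(u, u).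
   If M is nearly Kenmotsu, the left-hand side is - eta(u) g(phi u, w).  Taking
   u = xi, then eta(u) = 0 and w = xi, and then u + xi, one gets
   h(u, w) = - g(phi u, w) for u orthogonal to xi.  As h is symmetric and phi is
   skew, g(u, u) = - g(phi u, phi u), hence u = 0, which is absurd since
   dim M >= 3. *)

(* A connection is an operator on global smooth vector fields, so a condition at one point has to be
   tested on global fields. A coordinate frame cut off by a bump function provides them, and proving
   these fields smooth takes a calculus of smooth maps. Both defining conditions are then used at a
   single point and with X = Y only. The usual Gauss and Weingarten formulas differentiate fields
   along M with the connection of N, which accepts only fields on all of N. Working with the forms
   g(phi u, w) and G(J a, b) avoids this: each lives on the whole of its manifold, and [nu] is never
   differentiated. The price is the second derivative F'' of the inclusion in charts, which enters
   both the derivative of the 2-form and the Christoffel symbols. Its tangential parts cancel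
   because J is skew; its normal part joins the ambient Christoffel symbol to form h. Schwarz's
   theorem for F is needed for the symmetry of h. *)
Require Import Defs.
From HB Require Import structures.
From mathcomp Require Import all_boot all_order all_algebra.
From mathcomp Require Import all_classical all_reals all_analysis.
From mathcomp Require Import ring lra.
Set Implicit Arguments.
Unset Strict Implicit.
Unset Printing Implicit Defensive.
Import Order.TTheory GRing.Theory Num.Theory numFieldNormedType.Exports.
Local Open Scope classical_set_scope.
Local Open Scope ring_scope.

(** * Smooth functions *)

Section SmoothOn.
Context {R : realType} {V W : normedModType R}.
Implicit Types (U : set V) (f g : V -> W).

Lemma near_eq_expansion f g (x : V) : {near x, f =1 g} -> differentiable f x ->
  g \o shift x = cst (g x) + 'd f x +o_ 0 id.
Proof.
move=> fg df; apply/eqaddoP => e e0; have /eqaddoP/(_ e e0) H := diff_locally df.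
have fgx : f x = g x by exact: nbhs_singleton fg.
have fg0 : \forall h \near (0 : V), f (h + x) = g (h + x).
  have := fg; rewrite (near_shift 0 x) /=.
  by apply: filterS => h /=; rewrite subr0.
near=> h.
have E : f (h + x) = g (h + x) by near: h.
suff : `|(f \o shift x - (cst (f x) + 'd f x)) h| <= e * `|id h|.
  by rewrite /= !fctE /= E fgx.
by near: h.
Unshelve. all: by end_near. Qed.

Lemma near_eq_diff f g (x : V) : {near x, f =1 g} -> differentiable f x ->
  'd g x = 'd f x :> (V -> W).
Proof.
move=> fg df; apply: diff_unique (near_eq_expansion fg df).
exact: diff_continuous.
Qed.

Lemma near_eq_differentiable f g (x : V) :
  {near x, f =1 g} -> differentiable f x -> differentiable g x.
Proof.
move=> fg df; apply/diff_locallyP; rewrite (near_eq_diff fg df).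
by split; [exact: diff_continuous | exact: near_eq_expansion].
Qed.

Definition derivs (vs : seq V) f : V -> W :=
  foldr (fun v (h : V -> W) => 'D_v h : V -> W) f vs.

Lemma open_near U (P : V -> Prop) x :
  open U -> (forall y, U y -> P y) -> U x -> \forall y \near x, P y.
Proof. by move=> oU UP Ux; apply: filterS (open_nbhs_nbhs (conj oU Ux)). Qed.

Lemma derivs_eq_on U vs f g : open U -> (forall x, U x -> f x = g x) ->
  forall x, U x -> derivs vs f x = derivs vs g x.
Proof.
move=> oU fg; elim: vs => //= v vs IH x Ux.
by apply: near_eq_derive; apply: open_near Ux.
Qed.

Lemma smooth_on_differentiable U f x :
  smooth_on U f -> U x -> differentiable f x.
Proof. by move=> /(_ [::] x). Qed.

(** [foldr] differentiates along the last direction first, so appending v to the list puts ['D_v]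
    next to f. *)
Lemma smooth_on_derive U f v : smooth_on U f -> smooth_on U ('D_v f).
Proof. by move=> sf vs x Ux; have := sf (rcons vs v) x Ux; rewrite foldr_rcons. Qed.

(** Smoothness by coinduction: it suffices to find a class P that is stable under directional
    derivatives. Agreement on U is all that is asked of the derivative, because formulas for it hold
    only there; as U is open, the agreement survives further differentiation. *)
Lemma smooth_on_coind U (P : (V -> W) -> Prop) : open U ->
  (forall f, P f -> (forall x, U x -> differentiable f x) /\
    forall v, exists2 f', P f' & forall x, U x -> 'D_v f x = f' x) ->
  forall f, P f -> smooth_on U f.
Proof.
move=> oU HP f Pf vs; elim/last_ind: vs f Pf => [|vs v IH] f Pf x Ux /=.
  by have [+ _] := HP f Pf; apply.
have [_ /(_ v)[f' Pf' ff']] := HP f Pf; rewrite foldr_rcons.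
apply: near_eq_differentiable (IH f' Pf' x Ux).
apply: open_near Ux => // y Uy.
by apply/esym; exact: (derivs_eq_on vs oU ff').
Qed.

Lemma smooth_on_eq U f g : open U -> (forall x, U x -> f x = g x) ->
  smooth_on U f -> smooth_on U g.
Proof.
move=> oU fg sf vs x Ux; apply: near_eq_differentiable (sf vs x Ux).
by apply: open_near Ux => // y Uy; exact: (derivs_eq_on vs oU fg).
Qed.

Lemma smooth_on_cst U (w : W) : open U -> smooth_on U (cst w).
Proof.
move=> oU; apply: (smooth_on_coind (P := fun f => exists w, f = cst w)) => //;
  last by exists w.
move=> _ [{}w ->]; split => [x _|v]; first exact: differentiable_cst.
by exists (cst 0); [exists 0 | move=> x _; rewrite derive_cst].
Qed.

Lemma smooth_on_linear U (f : {linear V -> W}) :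
  open U -> continuous f -> smooth_on U f.
Proof.
move=> oU cf; have df x : differentiable f x by exact: linear_differentiable.
apply: (smooth_on_coind (P := fun g => g = f \/ exists w, g = cst w)) => //;
  last by left.
move=> _ [->|[w ->]]; split => [x _|v] //.
- exists (cst (f v)); first by right; exists (f v).
  by move=> x _; rewrite deriveE // diff_lin.
- by exists (cst 0); [right; exists 0 | move=> x _; rewrite derive_cst].
Qed.

End SmoothOn.

(** * Sums, products and compositions of smooth functions *)

Section SmoothScalar.
Context {R : realType} {V : normedModType R}.
Implicit Types (U : set V) (f g : V -> R).

(* The smallest class of functions containing the smooth ones and closed under
   sums, products and composition; it is closed under differentiation, whence
   these operations preserve smoothness.  Composition with h is formulated
   for maps with values in the span of a finite family e, so as to cover both
   R and row vectors. *)
Inductive smooth_closure U : (V -> R) -> Prop :=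
| smooth_closure_base f : smooth_on U f -> smooth_closure U f
| smooth_closureD f g : smooth_closure U f -> smooth_closure U g ->
    smooth_closure U (fun x => f x + g x)
| smooth_closureM f g : smooth_closure U f -> smooth_closure U g ->
    smooth_closure U (fun x => f x * g x)
| smooth_closure_comp (W : normedModType R) (B : set W) (h : W -> R) k
    (e : 'I_k -> W) (c : 'I_k -> V -> R) :
    smooth_on B h -> (forall i, smooth_closure U (c i)) ->
    (forall x, U x -> B (\sum_i c i x *: e i)) ->
    smooth_closure U (fun x => h (\sum_i c i x *: e i)).

Lemma is_diff_sumZ (W : normedModType R) k (e : 'I_k -> W) (c : 'I_k -> V -> R)
    x : (forall i, differentiable (c i) x) ->
  differentiable (fun y => \sum_i c i y *: e i) x /\
  forall v, 'd (fun y => \sum_i c i y *: e i) x v = \sum_i 'd (c i) x v *: e i.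
Proof.
move=> dc.
have -> : (fun y => \sum_i c i y *: e i) = \sum_i (fun y => c i y *: e i).
  by apply/funext => y; rewrite fct_sumE.
have di i : differentiable (fun y => c i y *: e i) x.
  by apply: differentiableZl.
split; first exact: differentiable_sum.
move=> v; rewrite -deriveE; last exact: differentiable_sum.
rewrite derive_sum; last by move=> i; exact: diff_derivable.
by apply: eq_bigr => i _; rewrite deriveE // diffZl.
Qed.

Lemma smooth_closure_sum U k (F : 'I_k -> V -> R) : open U ->
  (forall i, smooth_closure U (F i)) -> smooth_closure U (fun x => \sum_i F i x).
Proof.
move=> oU SF; have -> : (fun x => \sum_i F i x) = \sum_i F i.
  by apply/funext => x; rewrite fct_sumE.
elim/big_ind : _ => // [|f g]; last exact: smooth_closureD.
exact/smooth_closure_base/smooth_on_cst.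
Qed.

Lemma smooth_closure_derive U f : open U -> smooth_closure U f ->
  (forall x, U x -> differentiable f x) /\
  forall v, exists2 f', smooth_closure U f' & forall x, U x -> 'D_v f x = f' x.
Proof.
move=> oU; elim => {f} [f sf|f g _ [df Df] _ [dg Dg]|f g Sf [df Df] Sg [dg Dg]|
    W B h k e c sh Sc IH Bc].
- split => [x Ux|v]; first exact: smooth_on_differentiable Ux.
  by exists ('D_v f) => //; apply/smooth_closure_base/smooth_on_derive.
- split => [x Ux|v]; first by apply: differentiableD; [exact: df | exact: dg].
  have [f' Sf' Ef] := Df v; have [g' Sg' Eg] := Dg v.
  exists (fun x => f' x + g' x) => [|x Ux]; first exact: smooth_closureD.
  rewrite deriveD ?Ef ?Eg //; apply: diff_derivable; [exact: df | exact: dg].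
- split => [x Ux|v]; first by apply: differentiableM; [exact: df | exact: dg].
  have [f' Sf' Ef] := Df v; have [g' Sg' Eg] := Dg v.
  exists (fun x => f x * g' x + g x * f' x) => [|x Ux].
    by apply: smooth_closureD; exact: smooth_closureM.
  rewrite deriveM ?Ef ?Eg //; apply: diff_derivable; [exact: df | exact: dg].
- have dc i x : U x -> differentiable (c i) x by have [+ _] := IH i; apply.
  have dh x : U x -> differentiable h (\sum_i c i x *: e i).
    by move=> /Bc; exact: smooth_on_differentiable.
  have ds x (Ux : U x) := is_diff_sumZ e (fun i => dc i x Ux).
  split => [x Ux|v].
    by apply: (differentiable_comp (g := h)); [exact: (ds x Ux).1 | exact: dh].
  (* The derivatives of all the coefficients are chosen at once, since they occur together in one
     sum. *)
  have Dc i : {c' : V -> R | smooth_closure U c' /\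
      forall x, U x -> 'D_v (c i) x = c' x}.
    by apply/cid; have [_ /(_ v)[c' ? ?]] := IH i; exists c'.
  (* By the chain rule along the family e, each term is a product of a coefficient's derivative and
     a composition with ['D_(e i) h], which is again smooth on B. *)
  exists (fun x => \sum_i sval (Dc i) x * 'D_(e i) h (\sum_j c j x *: e j)).
    apply: smooth_closure_sum => // i.
    apply: smooth_closureM; first by case: (svalP (Dc i)).
    exact: (smooth_closure_comp (smooth_on_derive (e i) sh) Sc Bc).
  move=> x Ux; rewrite deriveE; last first.
    by apply: (differentiable_comp (g := h)); [exact: (ds x Ux).1 | exact: dh].
  rewrite (diff_comp (g := h)); [|exact: (ds x Ux).1 | exact: dh].
  rewrite /= (ds x Ux).2 linear_sum; apply: eq_bigr => i _.
  rewrite linearZ /= deriveE; last exact: dh.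
  by have [_ <-] := svalP (Dc i); rewrite // deriveE //; exact: dc.
Qed.

Lemma smooth_closure_smooth U f : open U -> smooth_closure U f -> smooth_on U f.
Proof.
by move=> oU; apply: smooth_on_coind f => // f /(smooth_closure_derive oU).
Qed.

Lemma smooth_onD U f g : open U -> smooth_on U f -> smooth_on U g ->
  smooth_on U (fun x => f x + g x).
Proof.
move=> oU sf sg; apply: smooth_closure_smooth => //.
by apply: smooth_closureD; exact: smooth_closure_base.
Qed.

Lemma smooth_onM U f g : open U -> smooth_on U f -> smooth_on U g ->
  smooth_on U (fun x => f x * g x).
Proof.
move=> oU sf sg; apply: smooth_closure_smooth => //.
by apply: smooth_closureM; exact: smooth_closure_base.
Qed.

Lemma smooth_on_sum U k (F : 'I_k -> V -> R) : open U ->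
  (forall i, smooth_on U (F i)) -> smooth_on U (fun x => \sum_i F i x).
Proof.
move=> oU sF; apply: smooth_closure_smooth => //.
by apply: smooth_closure_sum => // i; exact: smooth_closure_base.
Qed.

Lemma smooth_on_comp_real U f (h : R -> R) : open U ->
  smooth_on U f -> smooth_on setT h -> smooth_on U (h \o f).
Proof.
move=> oU sf sh; apply: smooth_closure_smooth => //.
have -> : h \o f = (fun x => h (\sum_(i < 1) f x *: 1)).
  by apply/funext => x /=; rewrite big_ord1 [_ *: _]mulr1.
by apply: smooth_closure_comp sh _ _ => // i; exact: smooth_closure_base.
Qed.

Lemma smooth_on_coord U m (F : V -> 'rV[R]_m) i :
  open U -> smooth_on U F -> smooth_on U (fun x => F x 0 i).
Proof.
move=> oU sF; apply: (smooth_on_coind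
  (P := fun f : V -> R => exists2 G : V -> 'rV[R]_m, smooth_on U G &
    f = (fun x => G x 0 i))) => //;
  last by exists F.
move=> _ [G sG ->].
have dG x : U x -> differentiable G x by exact: smooth_on_differentiable.
have dGi x : U x -> differentiable (fun x => G x 0 i) x.
  move=> /dG dGx; apply: (differentiable_comp (g := fun N : 'rV[R]_m => N 0 i)) => //.
  exact: differentiable_coord.
split => // v; exists (fun x => 'D_v G x 0 i).
  by exists ('D_v G) => //; exact: smooth_on_derive.
by move=> x Ux; rewrite derive_mx ?mxE //; exact/diff_derivable/dG.
Qed.

Lemma differentiable_mx m n (F : V -> 'M[R]_(m, n)) x :
  (forall i j, differentiable (fun x => F x i j) x) -> differentiable F x.
Proof.
move=> dF; have -> : F = \sum_i \sum_j (fun y => F y i j *: delta_mx i j).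
  apply/funext => y; rewrite [LHS]matrix_sum_delta fct_sumE.
  by apply: eq_bigr => i _; rewrite fct_sumE.
by do 2!apply: differentiable_sum => ?; exact: differentiableZl.
Qed.

Lemma smooth_on_rV U m (F : V -> 'rV[R]_m) :
  open U -> (forall i, smooth_on U (fun x => F x 0 i)) -> smooth_on U F.
Proof.
move=> oU sF; apply: (smooth_on_coind
  (P := fun G : V -> 'rV[R]_m => forall i, smooth_on U (fun x => G x 0 i))) => // G sG.
have dG x : U x -> differentiable G x.
  move=> Ux; apply: differentiable_mx => i j; rewrite [i]ord1.
  exact: smooth_on_differentiable Ux.
split => // v; exists (fun x => \row_i 'D_v (fun x => G x 0 i) x) => [i|x Ux].
  by under eq_fun do rewrite mxE; exact: smooth_on_derive.
by rewrite derive_mx; [apply/rowP => i; rewrite !mxE | exact/diff_derivable/dG].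
Qed.

Lemma smooth_onZ U m f (F : V -> 'rV[R]_m) : open U ->
  smooth_on U f -> smooth_on U F -> smooth_on U (fun x => f x *: F x).
Proof.
move=> oU sf sF; apply: smooth_on_rV => // i.
by under eq_fun do rewrite mxE; apply: smooth_onM => //; exact: smooth_on_coord.
Qed.

End SmoothScalar.

Lemma smooth_on_comp_scalar (R : realType) (V : normedModType R) m (U : set V)
    (B : set 'rV[R]_m) (f : V -> 'rV[R]_m) (h : 'rV[R]_m -> R) :
  open U -> smooth_on U f -> smooth_on B h ->
  (forall x, U x -> B (f x)) -> smooth_on U (h \o f).
Proof.
move=> oU sf sh UB; apply: smooth_closure_smooth => //.
have E x : f x = \sum_i f x 0 i *: delta_mx 0 i by rewrite -row_sum_delta.
have -> : h \o f = (fun x => h (\sum_i f x 0 i *: delta_mx 0 i)).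
  by apply/funext => x /=; rewrite -E.
apply: smooth_closure_comp sh _ _ => [j|x Ux].
- by apply: smooth_closure_base; exact: smooth_on_coord.
- by rewrite -E; exact: UB.
Qed.

Lemma smooth_on_comp (R : realType) (V : normedModType R) m k (U : set V)
    (B : set 'rV[R]_m) (f : V -> 'rV[R]_m) (h : 'rV[R]_m -> 'rV[R]_k) :
  open U -> open B -> smooth_on U f -> smooth_on B h ->
  (forall x, U x -> B (f x)) -> smooth_on U (h \o f).
Proof.
move=> oU oB sf sh UB; apply: smooth_on_rV => // i.
exact: (smooth_on_comp_scalar oU sf (smooth_on_coord i oB sh) UB).
Qed.

(** * Bump functions *)

Section Bump.
Context {R : realType}.

(** The bump function uses [flat 0] only; the powers of 1/t make the family stable, up to linear
    combinations, under differentiation. *)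
Definition flat k (t : R) : R := if 0 < t then t^-1 ^+ k * expR (- t^-1) else 0.

(** With s = 1/t this is the estimate of exp s from below by the term of degree k + 2 of its series.
    The quadratic order in t makes the difference quotient at 0 tend to 0. *)
Lemma flat_bound k (t : R) : `|flat k t| <= k.+2`!%:R * t ^+ 2.
Proof.
rewrite /flat; case: ifPn => [t0|_]; last first.
  by rewrite normr0 mulr_ge0 // ?ler0n // sqr_ge0.
have s0 : 0 < t^-1 by rewrite invr_gt0.
rewrite ger0_norm; last by rewrite mulr_ge0 ?expR_ge0 // exprn_ge0 // ltW.
have f0 : 0 < k.+2`!%:R :> R by rewrite ltr0n fact_gt0.
have := expR_ge1Dxn k.+1 (ltW s0) => H.
have {}H : t^-1 ^+ k.+2 <= k.+2`!%:R * expR t^-1.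
  rewrite -ler_pdivrMl // mulrC; apply: le_trans H.
  by rewrite lerDr.
rewrite expRN ler_pdivrMr ?expR_gt0 //.
have -> : t^-1 ^+ k = t^-1 ^+ k.+2 * t ^+ 2.
  by rewrite -addn2 exprD -mulrA -exprMn mulVf ?gt_eqF // expr1n mulr1.
by rewrite [leRHS]mulrAC ler_pM2r ?exprn_gt0.
Qed.

Lemma is_derive_flat k (t : R) :
  is_derive t 1 (flat k) (- (k%:R) * flat k.+1 t + flat k.+2 t).
Proof.
have [t0|t0|<-] := ltgtP 0 t.
- apply: (near_eq_is_derive (f := (fun s => s ^+ k * expR (- s)) \o (fun t => t^-1))).
    near=> y; rewrite /flat /= ifT //; near: y; exact: lt_nbhsr.
  have dinv : is_derive t 1 (fun t : R => t^-1) (- t ^- 2).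
    split; first by apply: derivableV => //; rewrite gt_eqF.
    by rewrite deriveV ?gt_eqF // derive_id [_ *: _]mulr1.
  have dg : is_derive t^-1 1 (fun s : R => s ^+ k * expR (- s))
      (t^-1 ^+ k * (- expR (- t^-1)) + expR (- t^-1) * (k%:R * t^-1 ^+ k.-1)).
    have dE : is_derive t^-1 1 (fun s : R => expR (- s)) (- expR (- t^-1)).
      have := @is_derive1_comp R expR -%R t^-1 (expR (- t^-1)) (-1) _ _.
      rewrite mulrN1; apply.
    have dX : is_derive t^-1 1 (fun s : R => s ^+ k) (k%:R * t^-1 ^+ k.-1).
      split; first exact: exprn_derivable.
      by rewrite exp_derive /GRing.scale /= mulr1.
    exact: (is_deriveM dX dE).
  have := is_derive1_comp dg dinv => /is_derive_eq; apply.
  rewrite /flat t0 -exprVn !exprS.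
  by case: k {dg} => [|k] /=; rewrite ?exprS; ring.
- have E j : flat j t = 0 by rewrite /flat ltNge (ltW t0).
  rewrite !E mulr0 addr0.
  apply: (near_eq_is_derive (f := cst 0)).
  near=> y; rewrite /flat ltNge ifF //; apply/negbTE/negPn; rewrite ltW //.
  near: y; exact: lt_nbhsl.
- have E j : flat j 0 = 0 by rewrite /flat ltxx.
  rewrite !E mulr0 addr0.
  have H : (fun h => h^-1 *: ((flat k \o shift 0) (h *: 1) - flat k 0)) @ 0^' --> (0 : R).
    apply/cvgrPdist_le => e e0; near=> h.
    rewrite sub0r normrN E subr0 /= addr0 [h *: 1]mulr1 normrM normfV.
    have h0 : 0 < `|h| by rewrite normr_gt0; near: h; exact: nbhs_dnbhs_neq.
    rewrite mulrC ler_pdivrMr // (le_trans (flat_bound k h)) // -real_normK ?num_real //.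
    rewrite expr2 mulrA ler_pM2r // -ler_pdivlMl ?ltr0n ?fact_gt0 //.
    near: h; apply: dnbhs0_le; rewrite mulr_gt0 // invr_gt0 ltr0n fact_gt0 //.
  by split; [apply/cvg_ex; exists 0 | exact: cvg_lim H].
Unshelve. all: by end_near. Qed.

Inductive flat_span : (R -> R) -> Prop :=
| flat_span_base k : flat_span (flat k)
| flat_spanD f g : flat_span f -> flat_span g -> flat_span (f + g)
| flat_spanZ a f : flat_span f -> flat_span (a *: f).

Lemma smooth_flat k : smooth_on setT (flat k).
Proof.
apply: (smooth_on_coind (P := flat_span)); [exact: openT| |exact: flat_span_base].
move=> f; elim => {f} [{}k|f g _ [df Df] _ [dg Dg]|a f _ [df Df]].
- have dk x : differentiable (flat k) x.
    by apply/derivable1_diffP; case: (is_derive_flat k x).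
  split => // v; exists (v *: (- (k%:R) *: flat k.+1 + flat k.+2)).
    by do ![apply: flat_spanZ || apply: flat_spanD || exact: flat_span_base].
  move=> x _; rewrite deriveE // -[v in LHS]mulr1 -[v * 1]/(v *: 1) linearZ /=.
  by rewrite -deriveE //; have [_ ->] := is_derive_flat k x.
- split => [x _|v]; first by apply: differentiableD; [exact: df | exact: dg].
  have [f' Sf Ef] := Df v; have [g' Sg Eg] := Dg v.
  exists (f' + g'); first exact: flat_spanD.
  move=> x _; rewrite deriveD ?Ef ?Eg //; apply: diff_derivable; [exact: df|exact: dg].
- split => [x _|v]; first by apply: differentiableZ; exact: df.
  have [f' Sf Ef] := Df v; exists (a *: f'); first exact: flat_spanZ.
  by move=> x _; rewrite deriveZ ?Ef //; apply: diff_derivable; exact: df.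
Qed.

(* With b0 a multiple of exp (-1 / (1 - |x - a|^2 / e^2)), the function
   b0 (2 - b0) = 1 - (1 - b0)^2 has vanishing derivative where b0 = 1. *)
Lemma bump_function m (a : 'rV[R]_m) (e : R) : 0 < e ->
  exists b : 'rV[R]_m -> R, [/\ smooth_on setT b, b a = 1,
    forall v, 'D_v b a = 0 & forall x, b x != 0 -> `|x - a| <= e].
Proof.
move=> e0.
pose q (x : 'rV[R]_m) := 1 + (- e ^- 2) *
  \sum_i (x 0 i + (- a 0 i)) * (x 0 i + (- a 0 i)).
pose b0 x := (flat 0 1)^-1 * flat 0 (q x).
have oT : open [set: 'rV[R]_m] by exact: openT.
have scst (c : R) : smooth_on [set: 'rV[R]_m] (fun=> c) by exact: smooth_on_cst.
have sq : smooth_on setT q.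
  apply: smooth_onD => //; apply: smooth_onM => //; apply: smooth_on_sum => // i.
  have sX : smooth_on setT (fun x : 'rV[R]_m => x 0 i).
    apply: (smooth_on_coord (F := idfun)) => //.
    by apply: (@smooth_on_linear _ _ _ _ idfun) => // x.
  by apply: smooth_onM => //; exact: smooth_onD.
have sb0 : smooth_on setT b0.
  apply: smooth_onM => //; apply: (smooth_on_comp_real (h := flat 0)) => //.
  exact: smooth_flat.
have sb1 : smooth_on setT (fun x => 2 + (-1) * b0 x).
  by apply: smooth_onD => //; exact: smooth_onM.
have b0a : b0 a = 1.
  rewrite /b0 /q big1 => [|i _]; last by rewrite subrr mulr0.
  by rewrite mulr0 addr0 mulVf // /flat ltr01 expr0 mul1r gt_eqF // expR_gt0.
have db0 v : derivable b0 a v by apply/diff_derivable/(smooth_on_differentiable sb0).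
exists (fun x => b0 x * (2 + (-1) * b0 x)); split => [||v|x].
- exact: smooth_onM.
- by rewrite b0a; ring.
- have db1 : derivable (fun x => 2 + (-1) * b0 x) a v.
    exact/diff_derivable/(smooth_on_differentiable sb1).
  rewrite deriveM // (_ : 'D_v (fun x => _) a = - 'D_v b0 a); last first.
    rewrite deriveD //; last exact: derivableZ.
    by rewrite (deriveZ (-1)) // derive_cst add0r scaleN1r.
  by rewrite b0a /GRing.scale /=; ring.
- rewrite mulf_eq0 negb_or => /andP[+ _]; rewrite mulf_eq0 negb_or => /andP[_].
  rewrite {1}/flat; case: ifP; rewrite ?eqxx // /q mulNr subr_gt0 => qx _.
  (* The norm of a row vector is the maximum of its entries, while [q] is built from the sum of
     squares, which dominates the square of each entry. *)
  rewrite /Num.Def.normr /= mx_normrE; apply: bigmax_le; first exact: ltW.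
  move=> [i j] _; rewrite !mxE /= [i]ord1; apply: ltW.
  rewrite -(ltr_pXn2r (n := 2)) ?nnegrE ?(ltW e0) // real_normK ?num_real //.
  rewrite mulrC ltr_pdivrMr ?exprn_gt0 // mul1r in qx.
  apply: le_lt_trans qx; rewrite (bigD1 j) //= -expr2 lerDl.
  by apply: sumr_ge0 => l _; rewrite -expr2 sqr_ge0.
Qed.

End Bump.

(** * Symmetry of second derivatives *)

Section Schwarz.
Context {R : realType} {V : normedModType R}.

Lemma is_derive_line (W : normedModType R) (f : V -> W) (y u : V) (s : R) :
  differentiable f (s *: u + y) ->
  is_derive s 1 (fun t => f (t *: u + y)) ('D_u f (s *: u + y)).
Proof.
move=> df; pose l (t : R) := t *: u + y.
have dl : is_diff s l ( *:%R^~ u + 0) by exact: is_diffD.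
have dfl : differentiable (f \o l) s by exact: differentiable_comp.
split; first exact: diff_derivable dfl.
rewrite -[fun t => _]/(f \o l) deriveE // diff_comp //= diff_val /=.
by rewrite !fctE addr0 scale1r deriveE.
Qed.

(* The mean value theorem in the direction u, then the first-order expansion
   of the derivative along u. *)
Lemma second_difference (f : V -> R) (x u v : V) (e : R) : 0 < e ->
  (\forall y \near x, differentiable f y) -> differentiable ('D_u f) x ->
  \forall h \near (0 : R)^'+,
    `|f (h *: u + (h *: v + x)) - f (h *: u + x) - f (h *: v + x) + f x
      - h ^+ 2 * 'D_v ('D_u f) x| <= e * h ^+ 2.
Proof.
move=> e0 df dp; set p := 'D_u f.
(* Two first-order remainders occur, each at most e/k times h (|u| + |v|); this k makes their sum at
   most e h, and the summand 1 keeps k positive. *)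
pose k := 2 * (`|u| + `|v|) + 1.
have k0 : 0 < k by rewrite /k ltr_wpDl // mulr_ge0 // addr_ge0.
have ek0 : 0 < e / k by exact: divr_gt0.
have /eqaddoP/(_ _ ek0) := diff_locally dp.
move=> /nbhs_ballP[r1 /= r1_gt0 Hr1].
move: df => /nbhs_ballP[r2 /= r2_gt0 Hr2].
have H1 (y : V) : `|y| < r1 -> `|p (y + x) - (p x + 'd p x y)| <= e / k * `|y|.
  by move=> yr; apply: (Hr1 y); rewrite -ball_normE /= sub0r normrN.
have H2 (y : V) : `|y| < r2 -> differentiable f (y + x).
  by move=> yr; apply: Hr2; rewrite -ball_normE /= opprD addrCA subrr addr0 normrN.
near=> h.
have h0 : 0 < h by near: h; exact: nbhs_right_gt.
have small : h * (`|u| + `|v|) < Num.min r1 r2.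
  have : h < Num.min r1 r2 / k.
    near: h; apply: nbhs_right_lt; rewrite divr_gt0 // lt_min r1_gt0 //.
  rewrite ltr_pdivlMr //; apply: le_lt_trans; rewrite ler_wpM2l // ?ltW // /k.
  have := normr_ge0 u; have := normr_ge0 v; lra.
have bnd (s t : R) : 0 <= s <= h -> 0 <= t <= h ->
    `|s *: u + t *: v| <= h * (`|u| + `|v|).
  move=> /andP[s0 sh] /andP[t0 th]; apply: le_trans (ler_normD _ _) _.
  by rewrite !normrZ !ger0_norm // mulrDr lerD // ler_wpM2r.
have bnd0 (s : R) : 0 <= s <= h -> `|s *: u| <= h * (`|u| + `|v|).
  by move=> sh; have := bnd s 0 sh; rewrite scale0r addr0 lexx ltW //; apply.
have {}small (z : V) : `|z| <= h * (`|u| + `|v|) -> `|z| < r1 /\ `|z| < r2.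
  by move=> /le_lt_trans/(_ small); rewrite lt_min => /andP[].
have hh : 0 <= h <= h by rewrite lexx ltW.
have dg (s : R) : 0 <= s <= h ->
    is_derive s 1 (fun s => f (s *: u + (h *: v + x)) - f (s *: u + x))
      (p (s *: u + (h *: v + x)) - p (s *: u + x)).
  move=> sh; apply: is_deriveB; apply: is_derive_line; rewrite ?addrA.
    by apply: H2; exact: (small _ (bnd s h sh hh)).2.
  by apply: H2; exact: (small _ (bnd0 s sh)).2.
have [||c ch] := MVT h0 (f := fun s => f (s *: u + (h *: v + x)) - f (s *: u + x))
    (df := fun s => p (s *: u + (h *: v + x)) - p (s *: u + x)).
- by move=> s; rewrite in_itv /= => /andP[s0 sh]; apply: dg; rewrite !ltW.
- apply: derivable_within_continuous => s; rewrite in_itv /= => sh.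
  by case: (dg s sh).
rewrite !scale0r !add0r subr0 => E.
rewrite (_ : f _ - _ - _ + _ = (p (c *: u + (h *: v + x)) - p (c *: u + x)) * h);
  last by rewrite -E; ring.
have {}ch : 0 <= c <= h.
  by move: ch; rewrite in_itv /= => /andP[? ?]; rewrite !ltW.
have B1 := bnd c h ch hh; have B2 := bnd0 c ch.
have := H1 _ (small _ B1).1; have := H1 _ (small _ B2).1.
have EA : 'd p x (c *: u + h *: v) = c * 'd p x u + h * 'd p x v.
  by rewrite linearD !linearZ.
have EB : 'd p x (c *: u) = c * 'd p x u by rewrite linearZ.
rewrite EA EB !addrA deriveE // -/p.
set A := p (_ + _ + _); set B := p (_ + x); set C := 'd p x u; set D := 'd p x v.
move=> I2 I1.
rewrite (_ : _ * h - h ^+ 2 * _ = h * ((A - B) - h * D)); last by ring.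
rewrite normrM (gtr0_norm h0) expr2 mulrCA ler_pM2l //.
have K : e / k * (h * (`|u| + `|v|)) * 2 <= e * h.
  have : e / k * k = e by rewrite divfK // gt_eqF.
  rewrite {2}/k => Ek; have : 0 <= e / k * h by rewrite mulr_ge0 // ltW.
  have -> : e * h = e / k * (2 * (`|u| + `|v|) + 1) * h by rewrite Ek.
  by move: (e / k) => q ?; lra.
apply: le_trans K; rewrite mulr2n mulrDr mulr1.
have -> : A - B - h * D = (A - (p x + c * C + h * D)) - (B - (p x + c * C)).
  by ring.
apply: le_trans (ler_normB _ _) _; apply: lerD.
  by apply: le_trans I1 _; rewrite ler_wpM2l // ltW.
by apply: le_trans I2 _; rewrite ler_wpM2l // ltW.
Unshelve. all: by end_near. Qed.

(** The second difference is symmetric in u and v, so for small h it lies within (e/2) h^2 of h^2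
    times either iterated derivative. Hence these differ by at most e. *)
Lemma deriveC (U : set V) (f : V -> R) (x u v : V) : open U ->
  smooth_on U f -> U x -> 'D_u ('D_v f) x = 'D_v ('D_u f) x.
Proof.
move=> oU sf Ux; apply/eqP; rewrite -subr_eq0 -normr_le0.
apply/ler_addgt0Pr => e e0; rewrite add0r.
have ndf : \forall y \near x, differentiable f y.
  by apply: open_near Ux => // y; exact: smooth_on_differentiable.
have dD w : differentiable ('D_w f) x.
  exact: smooth_on_differentiable (smooth_on_derive w sf) Ux.
have e20 : 0 < e / 2 by rewrite divr_gt0.
have H1 := second_difference v e20 ndf (dD u).
have H2 := second_difference u e20 ndf (dD v).
have [h [h0 [I1 I2]]] :=
  filter_ex (filterI (nbhs_right_gt (0 : R)) (filterI H1 H2)).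
have h20 : 0 < h ^+ 2 by rewrite exprn_gt0.
rewrite -(ler_pM2r h20) -{1}(gtr0_norm h20) -normrM.
rewrite (_ : e * _ = e / 2 * h ^+ 2 + e / 2 * h ^+ 2); last by rewrite -mulrDl -splitr.
apply: le_trans (lerD I1 I2); apply: le_trans (ler_normB _ _).
rewrite (addrCA (h *: v)).
have alg (a b c d q A B : R) :
    (B - A) * q = (a - b - c + d - q * A) - (a - c - b + d - q * B) by ring.
by rewrite -alg.
Qed.

Lemma derive_rVC (U : set V) m (f : V -> 'rV[R]_m) (x u v : V) : open U ->
  smooth_on U f -> U x -> 'D_u ('D_v f) x = 'D_v ('D_u f) x.
Proof.
move=> oU sf Ux; apply/rowP => i.
have E w z : 'D_w ('D_z f) x 0 i = 'D_w ('D_z (fun y => f y 0 i)) x.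
  have dDf : derivable ('D_z f) x w.
    exact/diff_derivable/smooth_on_differentiable/Ux/smooth_on_derive.
  rewrite derive_mx // mxE; apply: near_eq_derive.
  apply: (open_near oU _ Ux) => y Uy.
  have dfy : derivable f y z by exact/diff_derivable/(smooth_on_differentiable sf).
  by rewrite derive_mx // mxE.
apply: etrans (E u v) (etrans _ (esym (E v u))).
exact: deriveC oU (smooth_on_coord i oU sf) Ux.
Qed.

End Schwarz.

(** * Christoffel symbols *)

Section Pairing.
Context {R : realType} {m : nat}.
Implicit Types (B : 'M[R]_m) (u v w : 'rV[R]_m) (a : R).

Lemma pairingDl B u v w : pairing B (u + v) w = pairing B u w + pairing B v w.
Proof. by rewrite /pairing !mulmxDl mxE. Qed.

Lemma pairingDr B u v w : pairing B u (v + w) = pairing B u v + pairing B u w.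
Proof. by rewrite /pairing linearD mulmxDr mxE. Qed.

Lemma pairingZl B a u v : pairing B (a *: u) v = a * pairing B u v.
Proof. by rewrite /pairing -!scalemxAl mxE. Qed.

Lemma pairingZr B a u v : pairing B u (a *: v) = a * pairing B u v.
Proof. by rewrite /pairing linearZ -scalemxAr mxE. Qed.

Lemma pairingNl B u v : pairing B (- u) v = - pairing B u v.
Proof. by rewrite -scaleN1r pairingZl mulN1r. Qed.

Lemma pairingNr B u v : pairing B u (- v) = - pairing B u v.
Proof. by rewrite -scaleN1r pairingZr mulN1r. Qed.

Lemma pairing0l B v : pairing B 0 v = 0.
Proof. by rewrite /pairing !mul0mx mxE. Qed.

Lemma pairing0r B v : pairing B v 0 = 0.
Proof. by rewrite /pairing trmx0 mulmx0 mxE. Qed.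

Lemma pairing_delta B i j : pairing B (delta_mx 0 i) (delta_mx 0 j) = B i j.
Proof. by rewrite /pairing -rowE trmx_delta -colE !mxE. Qed.

End Pairing.

(** * The product rule for matrix products and pairings *)

Section PairingDerivative.
Context {R : realType} {V : normedModType R}.

Lemma is_derive_mx m n (A : V -> 'M[R]_(m, n)) (x w : V) (dA : 'M[R]_(m, n)) :
  is_derive x w A dA <->
  forall i j, is_derive x w (fun y => A y i j) (dA i j).
Proof.
split=> [[dvA <-] i j|dAij].
  by rewrite derive_mx // mxE; exact/derivableP/((derivable_mxP A x w).1 dvA).
have dvA : derivable A x w by apply/derivable_mxP => i j; case: (dAij i j).
split=> //; rewrite derive_mx //; apply/matrixP => i j.
by rewrite mxE; case: (dAij i j).
Qed.

Lemma is_derive_tr m n (A : V -> 'M[R]_(m, n)) (x w : V) dA :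
  is_derive x w A dA -> is_derive x w (fun y => (A y)^T) dA^T.
Proof.
move=> /is_derive_mx dAij; apply/is_derive_mx => i j; rewrite mxE.
by under eq_fun do rewrite mxE.
Qed.

Lemma is_derive_mulmx m n p (A : V -> 'M[R]_(m, n)) (B : V -> 'M[R]_(n, p))
    (x w : V) dA dB : is_derive x w A dA -> is_derive x w B dB ->
  is_derive x w (fun y => A y *m B y) (dA *m B x + A x *m dB).
Proof.
move=> /is_derive_mx dAij /is_derive_mx dBij; apply/is_derive_mx => i j.
rewrite !mxE -big_split /=; under eq_fun do rewrite mxE.
have -> : (fun y => \sum_k A y i k * B y k j) =
    \sum_k (fun y => A y i k * B y k j).
  by apply/funext => y; rewrite fct_sumE.
apply: is_derive_sum => k.
have /is_derive_eq := is_deriveM (dAij i k) (dBij k j); apply.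
by rewrite /GRing.scale /=; ring.
Qed.

Lemma is_derive_pairing m (B : V -> 'M[R]_m) (a b : V -> 'rV[R]_m)
    (x w : V) dB da db :
  is_derive x w B dB -> is_derive x w a da -> is_derive x w b db ->
  is_derive x w (fun y => pairing (B y) (a y) (b y))
    (pairing dB (a x) (b x) + pairing (B x) da (b x) + pairing (B x) (a x) db).
Proof.
move=> dB' da' db'.
have /is_derive_mx/(_ 0 0) :=
  is_derive_mulmx (is_derive_mulmx da' dB') (is_derive_tr db').
have mxD (X Y : 'M[R]_1) : (X + Y) 0 0 = X 0 0 + Y 0 0 by rewrite mxE.
by move=> /is_derive_eq; apply; rewrite mulmxDl !mxD /pairing; congr (_ + _); rewrite addrC.
Qed.

Lemma derive_pairing_cst m (B : V -> 'M[R]_m) (x w : V) u v :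
  derivable B x w ->
  'D_w (fun y => pairing (B y) u v) x = pairing ('D_w B x) u v.
Proof.
move=> dB; have [_] := is_derive_pairing (derivableP dB)
  (is_derive_cst u x w) (is_derive_cst v x w).
by rewrite /cst => ->; rewrite pairing0l pairing0r !addr0.
Qed.

End PairingDerivative.

Section Christoffel.
Context {R : realType}.

(* The symbol of the first kind Gamma_(ab, c). *)
Definition christoffel k (B : 'rV[R]_k -> 'M[R]_k) (y a b c : 'rV[R]_k) : R :=
  (pairing ('D_a B y) b c + pairing ('D_b B y) a c - pairing ('D_c B y) a b) / 2.

Context {m k : nat}.
Variables (U : set 'rV[R]_m) (F : 'rV[R]_m -> 'rV[R]_k) (x : 'rV[R]_m).
Hypotheses (oU : open U) (sF : smooth_on U F) (Ux : U x).
Variable (H : 'rV[R]_m -> 'rV[R]_m -> 'rV[R]_k).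
Hypothesis (FH : forall a b, 'D_a ('D_b F) x = H a b).

(** Product rule and chain rule; the two terms with [H] measure how far F is from being affine. *)
Lemma derive_pullback (b : 'rV[R]_m -> 'M[R]_m) (B : 'rV[R]_k -> 'M[R]_k)
    (u v w : 'rV[R]_m) :
  differentiable b x -> differentiable B (F x) ->
  (forall y, U y -> forall u v,
     pairing (b y) u v = pairing (B (F y)) ('D_u F y) ('D_v F y)) ->
  pairing ('D_w b x) u v = pairing ('D_('D_w F x) B (F x)) ('D_u F x) ('D_v F x)
    + pairing (B (F x)) (H w u) ('D_v F x)
    + pairing (B (F x)) ('D_u F x) (H w v).
Proof.
move=> db dB bB; rewrite -derive_pairing_cst; last exact: diff_derivable.
have -> : 'D_w (fun y => pairing (b y) u v) x =
    'D_w (fun y => pairing (B (F y)) ('D_u F y) ('D_v F y)) x.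
  by apply: near_eq_derive; apply: (open_near oU _ Ux) => y Uy; exact: bB.
have dF : differentiable F x by exact: smooth_on_differentiable Ux.
have dBF : is_derive x w (B \o F) ('D_('D_w F x) B (F x)).
  have dc : differentiable (B \o F) x by exact: differentiable_comp.
  split; first exact: diff_derivable.
  by rewrite deriveE // diff_comp //= !deriveE.
have dDF z : is_derive x w ('D_z F) ('D_w ('D_z F) x).
  apply/derivableP/diff_derivable.
  exact: smooth_on_differentiable (smooth_on_derive z sF) Ux.
rewrite -(FH w u) -(FH w v).
by have [_ ->] := is_derive_pairing dBF (dDF u) (dDF v).
Qed.

(** The three derivatives in the symbol contribute six terms with [H]. As [H] and G are symmetric,
    four of them cancel and the other two coincide, which absorbs the factor 1/2. *)
Lemma christoffel_pullback (g : 'rV[R]_m -> 'M[R]_m) (G : 'rV[R]_k -> 'M[R]_k)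
    (u v w : 'rV[R]_m) :
  differentiable g x -> differentiable G (F x) ->
  (forall a b, pairing (G (F x)) a b = pairing (G (F x)) b a) ->
  (forall y, U y -> forall u v,
     pairing (g y) u v = pairing (G (F y)) ('D_u F y) ('D_v F y)) ->
  christoffel g x u v w =
    christoffel G (F x) ('D_u F x) ('D_v F x) ('D_w F x)
    + pairing (G (F x)) (H u v) ('D_w F x).
Proof.
move=> dg dG symG gG; rewrite /christoffel.
rewrite (derive_pullback v w u dg dG gG) (derive_pullback u w v dg dG gG).
rewrite (derive_pullback u v w dg dG gG).
have symH a b : H a b = H b a.
  by rewrite -FH -[RHS]FH; exact: derive_rVC oU sF Ux.
rewrite (symH v u) (symH w u) (symH w v) (symG _ (H u w)).
have alg (p1 p2 p3 q r s : R) :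
    ((p1 + q + r) + (p2 + q + s) - (p3 + r + s)) / 2 = (p1 + p2 - p3) / 2 + q.
  by field.
exact: alg.
Qed.

End Christoffel.

(** * Charts and vector fields *)

(** The composite [k] is prescribed only near x, and the intermediate point only up to an equation,
    because a chart cancels against its inverse only inside its domain. *)
Lemma chain_rule (R : realType) (V1 V2 V3 : normedModType R) (f : V1 -> V2)
    (h : V2 -> V3) (k : V1 -> V3) (x v : V1) (z : V2) :
  f x = z -> differentiable f x -> differentiable h z ->
  (\forall y \near x, h (f y) = k y) ->
  differentiable k x /\ 'd k x v = 'd h z ('d f x v).
Proof.
move=> <- df dh hk; have dc : differentiable (h \o f) x by exact: differentiable_comp.
split; first exact: near_eq_differentiable dc.
by rewrite (near_eq_diff hk dc) diff_comp.
Qed.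

Arguments chart_dom_open {R m T} c.
Arguments chart_im_open {R m T} c.
Arguments chart_inv_cont {R m T} c.

Section Charts.
Context {R : realType} {m : nat} (M : manifold R m).
Implicit Types (c d e : chart R m M) (p q : M) (v : 'rV[R]_m).

Lemma chart_image_invP c (O : set M) x :
  (c @` (chart_dom c `&` O)) x <->
  (c @` chart_dom c) x /\ O (chart_inv c x).
Proof.
split=> [[p [cp Op] <-]|[[p cp <-]]].
  by split; [exists p | rewrite chart_mapK].
by rewrite chart_mapK // => Op; exists p.
Qed.

Lemma open_chart_image c (O : set M) :
  open O -> open (c @` (chart_dom c `&` O)).
Proof.
move=> oO; have -> : c @` (chart_dom c `&` O) =
    c @` chart_dom c `&` chart_inv c @^-1` O.
  by apply/seteqP; split => x /chart_image_invP.
have := chart_inv_cont c; rewrite continuous_open_subspace; last exact: chart_im_open.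
by move=> /(continuous_inP _ (chart_im_open c)); apply.
Qed.

Lemma open_chart_overlap c d : open (c @` (chart_dom c `&` chart_dom d)).
Proof. exact/open_chart_image/chart_dom_open. Qed.

Arguments open_chart_overlap c d : clear implicits.

Lemma near_chart_image c (O : set M) p : open O -> chart_dom c p -> O p ->
  \forall y \near c p, (c @` chart_dom c) y /\ O (chart_inv c y).
Proof.
move=> oO cp Op.
have : nbhs (c p) (c @` (chart_dom c `&` O)).
  by apply: open_nbhs_nbhs; split; [exact: open_chart_image | exists p].
by apply: filterS => y /chart_image_invP.
Qed.

Lemma transition_differentiable c d p : atlas c -> atlas d ->
  chart_dom c p -> chart_dom d p -> differentiable (d \o chart_inv c) (c p).
Proof.
move=> ac ad cp dp.
by apply: smooth_on_differentiable (transition_smooth ac ad) _; exists p.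
Qed.

Lemma diff_transition c d e p v : atlas c -> atlas d -> atlas e ->
  chart_dom c p -> chart_dom d p -> chart_dom e p ->
  'd (e \o chart_inv c) (c p) v =
  'd (e \o chart_inv d) (d p) ('d (d \o chart_inv c) (c p) v).
Proof.
move=> ac ad ae cp dp ep.
apply: (chain_rule v _ _ _ _).2.
- by rewrite /= chart_mapK.
- exact: transition_differentiable.
- exact: transition_differentiable.
- apply: filterS (near_chart_image (chart_dom_open d) cp dp) => y [_ dy] /=.
  by rewrite chart_mapK.
Qed.

Lemma diff_transition_id c p v : chart_dom c p ->
  'd (c \o chart_inv c) (c p) v = v.
Proof.
move=> cp; have H : \forall y \near c p, idfun y = (c \o chart_inv c) y.
  apply: filterS (near_chart_image openT cp I) => _ [[q cq <-] _] /=.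
  by rewrite chart_mapK.
by rewrite (near_eq_diff H) // diff_val.
Qed.

Lemma of_coordsE c p v : chart_dom c p ->
  of_coords c (c p) v = 'd (chart_at p \o chart_inv c) (c p) v.
Proof. by move=> cp; rewrite /of_coords chart_mapK. Qed.

Lemma coords_of_coords c d p v : atlas c -> atlas d ->
  chart_dom c p -> chart_dom d p ->
  coords d p (of_coords c (c p) v) = 'd (d \o chart_inv c) (c p) v.
Proof.
move=> ac ad cp dp; rewrite of_coordsE //; apply: esym.
exact: (diff_transition v ac (chart_at_atlas p) ad cp (chart_at_dom p) dp).
Qed.

Lemma of_coordsK c p v : atlas c -> chart_dom c p ->
  coords c p (of_coords c (c p) v) = v.
Proof. by move=> ac cp; rewrite coords_of_coords // diff_transition_id. Qed.

Lemma coordsK c p v : atlas c -> chart_dom c p ->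
  of_coords c (c p) (coords c p v) = v.
Proof.
move=> ac cp; rewrite of_coordsE // -[RHS](diff_transition_id v (chart_at_dom p)).
have ap := chart_at_atlas p; have dp := chart_at_dom p.
exact: esym (diff_transition v ap ac ap dp cp dp).
Qed.

Lemma of_coords_chart_at p v : of_coords (chart_at p) (chart_at p p) v = v.
Proof.
have dp := chart_at_dom p.
by rewrite of_coordsE // diff_transition_id.
Qed.

Lemma of_coords_sum c x v :
  of_coords c x v = \sum_i v 0 i *: of_coords c x (delta_mx 0 i).
Proof.
rewrite {1}(row_sum_delta v) /of_coords linear_sum.
by apply: eq_bigr => i _; rewrite linearZ.
Qed.

(** [smooth_endo] speaks of fields with constant coordinates only, so X is expanded in the
    coordinate basis, with its coordinates as smooth coefficients. *)
Lemma smooth_vf_endo (A : M -> 'M[R]_m) (X : M -> 'rV[R]_m) :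
  smooth_endo A -> smooth_vf X -> smooth_vf (fun q => X q *m A q).
Proof.
move=> sA sX c ac; have oc := chart_im_open c.
pose S x := \sum_i vf_coords c X x 0 i *:
  coords c (chart_inv c x) (of_coords c x (delta_mx 0 i) *m A (chart_inv c x)).
apply: (@smooth_on_eq _ _ _ _ S) => // [_ [q cq <-]|].
  rewrite /S /vf_coords chart_mapK // -[X in coords _ _ (X *m _)](coordsK _ ac cq).
  rewrite [X in coords _ _ (X *m _)]of_coords_sum mulmx_suml [RHS]linear_sum.
  by apply: eq_bigr => i _; rewrite -scalemxAl [RHS]linearZ.
apply: smooth_on_rV => // j.
under eq_fun do rewrite summxE.
apply: smooth_on_sum => // i; under eq_fun do rewrite mxE.
apply: smooth_onM => //; first exact: smooth_on_coord (sX c ac).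
exact: smooth_on_coord (sA c _ ac).
Qed.

(** In the row vector convention the product matrix represents B(A u, v); for A = phi and B = g it
    is the 2-form g(phi u, v). *)
Lemma smooth_bilin_endo (A B : M -> 'M[R]_m) :
  smooth_endo A -> smooth_bilin B -> smooth_bilin (fun q => A q *m B q).
Proof.
move=> sA sB c u v ac; have oc := chart_im_open c.
pose w x := coords c (chart_inv c x) (of_coords c x u *m A (chart_inv c x)).
pose S x := \sum_i w x 0 i *
  pairing (B (chart_inv c x)) (of_coords c x (delta_mx 0 i)) (of_coords c x v).
apply: (@smooth_on_eq _ _ _ _ S) => // [_ [q cq <-]|].
  rewrite /S /w chart_mapK //.
  transitivity (pairing (B q) (of_coords c (c q) u *m A q) (of_coords c (c q) v));
    last by rewrite /pairing !mulmxA.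
  rewrite -[X in _ = pairing _ X _](coordsK _ ac cq).
  rewrite [X in _ = pairing _ X _]of_coords_sum /pairing !mulmx_suml summxE.
  by apply: eq_bigr => i _; rewrite -!scalemxAl [RHS]mxE.
apply: smooth_on_sum => // i; apply: smooth_onM => //.
  exact: smooth_on_coord (sA c _ ac).
exact: sB.
Qed.

(* The matrix of the bilinear form B in the coordinates of c. *)
Definition chart_form c (B : M -> 'M[R]_m) (x : 'rV[R]_m) : 'M[R]_m :=
  let T := 'J (chart_at (chart_inv c x) \o chart_inv c) x in
  T *m B (chart_inv c x) *m T^T.

Lemma pairing_chart_form c B x u v : pairing (chart_form c B x) u v =
  pairing (B (chart_inv c x)) (of_coords c x u) (of_coords c x v).
Proof.
rewrite /pairing /chart_form /of_coords; set T := jacobian _ _.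
by rewrite -!(mul_rV_lin1 ('d _ x)) -/T trmx_mul !mulmxA.
Qed.

Lemma chart_form_differentiable c B p : smooth_bilin B -> atlas c ->
  chart_dom c p -> differentiable (chart_form c B) (c p).
Proof.
move=> sB ac cp; apply: differentiable_mx => i j.
under eq_fun do rewrite -pairing_delta pairing_chart_form.
by apply: smooth_on_differentiable (sB c _ _ ac) _; exists p.
Qed.

(** The image of the ball is compact, hence closed because the manifold is Hausdorff. This is what
    allows a field supported in it to be extended by 0 smoothly. *)
Lemma closed_chart_inv_ball c (a : 'rV[R]_m) (r : R) :
  closed_ball_ Num.Def.normr a r `<=` c @` chart_dom c ->
  closed (chart_inv c @` closed_ball_ Num.Def.normr a r).
Proof.
move=> sub; apply: compact_closed; first exact: manifold_hausdorff.
apply: continuous_compact.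
  by apply: continuous_subspaceW sub _; exact: chart_inv_cont.
apply: bounded_closed_compact; last exact: closed_closed_ball_.
exists (`|a| + r); split=> [|N rN x /= ax]; first exact: num_real.
apply: le_trans (ltW rN); rewrite -[x](subrK a) addrC.
by rewrite (le_trans (ler_normD _ _)) // lerD2l distrC.
Qed.

(* Coordinate vector fields cut off by a bump function b.  As b = 1 and db = 0
   at p, b does not affect first derivatives at p. *)
Lemma local_frame p : exists (X : 'rV[R]_m -> M -> 'rV[R]_m)
    (b : 'rV[R]_m -> R),
  [/\ forall v, smooth_vf (X v), smooth_on setT b, b (chart_at p p) = 1,
    forall v, 'D_v b (chart_at p p) = 0 &
    forall v q, chart_dom (chart_at p) q ->
      X v q = b (chart_at p q) *: of_coords (chart_at p) (chart_at p q) v].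
Proof.
set c := chart_at p; have cp : chart_dom c p := chart_at_dom p.
have ac : atlas c := chart_at_atlas p.
have : nbhs (c p) (c @` chart_dom c).
  by apply: open_nbhs_nbhs; split; [exact: chart_im_open | exists p].
move=> /nbhs_closedballP[s]; have : 0 < s%:num by [].
move: (s%:num) => {s} r r0; rewrite closed_ballE // => sub.
have [b [sb b1 db supp]] := bump_function (c p) r0.
pose X v q := if `[< chart_dom c q >] then b (c q) *: of_coords c (c q) v else 0.
exists X, b; split => // [v d ad|v q cq]; last by rewrite /X asboolT.
move=> vs x [q dq <-]; have [cq|ncq] := pselect (chart_dom c q).
  have oU := open_chart_overlap d c; have oV := open_chart_overlap c d.
  suff /(_ vs (d q)) : smooth_on (d @` (chart_dom d `&` chart_dom c))
    (vf_coords d (X v)) by apply; exists q.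
  (* Read in d, the field is b times the v-derivative of the transition from c to d, both composed
     with the transition back from d to c. *)
  apply: (@smooth_on_eq _ _ _ _ (fun y => (b \o (c \o chart_inv d)) y *:
      ('D_v (d \o chart_inv c) \o (c \o chart_inv d)) y)) => //.
    move=> _ [q' [dq' cq'] <-]; rewrite /vf_coords /= chart_mapK //.
    rewrite /X asboolT // /coords linearZ /= -/(coords _ _ _).
    by rewrite coords_of_coords // deriveE //; exact: transition_differentiable.
  have st : smooth_on (d @` (chart_dom d `&` chart_dom c)) (c \o chart_inv d).
    exact: transition_smooth.
  apply: smooth_onZ => //.
    exact: (smooth_on_comp_scalar oU st sb).
  apply: smooth_on_comp oV st _ _ => //.
    by apply: smooth_on_derive; exact: transition_smooth.
  move=> _ [q' [dq' cq'] <-] /=; rewrite chart_mapK //; exists q' => //.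
(* Here q lies outside the domain of c. The complement of [K] is an open neighbourhood of q on which
   the field vanishes: by its default value off the domain of c, and because b vanishes on the
   rest. *)
set K := chart_inv c @` closed_ball_ Num.Def.normr (c p) r.
have cK : closed K by exact: closed_chart_inv_ball.
have nKq : ~ K q.
  move=> [y /sub[q' cq' <-]]; rewrite chart_mapK // => E; apply: ncq.
  by rewrite -E.
have oU : open (d @` (chart_dom d `&` ~` K)).
  by apply: open_chart_image; rewrite openC.
suff /(_ vs (d q)) : smooth_on (d @` (chart_dom d `&` ~` K)) (vf_coords d (X v)).
  by apply; exists q.
apply: (@smooth_on_eq _ _ _ _ (cst 0)) => //; last exact: smooth_on_cst.
move=> _ [q' [dq' nKq'] <-]; rewrite /vf_coords chart_mapK //.
rewrite (_ : X v q' = 0) ?[RHS]linear0 // /X; case: asboolP => // cq'.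
have [->|/supp bq] := eqVneq (b (c q')) 0; first by rewrite scale0r.
exfalso; apply: nKq'; exists (c q'); last by rewrite chart_mapK.
by rewrite /closed_ball_ /= distrC.
Qed.

End Charts.

(** * The Levi-Civita connection in a chart *)

Section LeviCivita.
Context {R : realType} {m : nat} (M : manifold R m).
Variables (g : M -> 'M[R]_m)
  (nabla : (M -> 'rV[R]_m) -> (M -> 'rV[R]_m) -> M -> 'rV[R]_m).
Hypotheses (hg : riemannian_metric g) (hn : levi_civita g nabla).
Variable p : M.
Let c := chart_at p.
Variables (X : 'rV[R]_m -> M -> 'rV[R]_m) (b : 'rV[R]_m -> R).
Hypotheses (sX : forall v, smooth_vf (X v)) (sb : smooth_on setT b)
  (b1 : b (c p) = 1) (db : forall v, 'D_v b (c p) = 0)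
  (Xb : forall v q, chart_dom c q -> X v q = b (c q) *: of_coords c (c q) v).

Let cp : chart_dom c p. Proof. exact: chart_at_dom. Qed.
Let ac : atlas c. Proof. exact: chart_at_atlas. Qed.
Let bdiff : differentiable b (c p).
Proof. exact: smooth_on_differentiable sb I. Qed.

Lemma frame_at v : X v p = v.
Proof. by rewrite Xb // b1 scale1r of_coords_chart_at. Qed.

Lemma frame_bracket u v : lie_bracket (X u) (X v) p = 0.
Proof.
have d0 w z : 'd (vf_coords c (X w)) (c p) z = 0.
  have H : \forall y \near c p, b y *: w = vf_coords c (X w) y.
    apply: filterS (near_chart_image openT cp I) => _ [[q cq <-] _].
    rewrite /vf_coords chart_mapK // Xb // /coords linearZ /=.
    by rewrite -/(coords _ _ _) of_coordsK.
  rewrite (near_eq_diff H); last exact: differentiableZl.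
  by rewrite diffZl // -deriveE // db scale0r.
by apply/eqP; rewrite subr_eq0; apply/eqP; exact: etrans (d0 _ _) (esym (d0 _ _)).
Qed.

Lemma frame_derive (B : M -> 'M[R]_m) (Y : M -> 'rV[R]_m) u v :
  smooth_bilin B ->
  dirderiv Y (fun q => pairing (B q) (X u q) (X v q)) p =
  pairing ('D_(Y p) (chart_form c B) (c p)) u v.
Proof.
move=> sB; pose f y := pairing (chart_form c B y) u v.
have dB : differentiable (chart_form c B) (c p) by exact: chart_form_differentiable.
have df : differentiable f (c p).
  rewrite /f; under eq_fun do rewrite pairing_chart_form.
  by apply: smooth_on_differentiable (sB c _ _ ac) _; exists p.
(* Bilinearity collects the two cut-offs into the factor b^2, which is 1 at p and has derivative 2 b
   b' = 0 there. *)
have H : \forall y \near c p, (b y * b y) * f y =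
    ((fun q => pairing (B q) (X u q) (X v q)) \o chart_inv c) y.
  apply: filterS (near_chart_image openT cp I) => _ [[q cq <-] _] /=.
  rewrite /f pairing_chart_form chart_mapK // !Xb // pairingZl pairingZr.
  by rewrite mulrA.
have dbb : differentiable (fun y => b y * b y) (c p) by exact: differentiableM.
have dbf : differentiable (fun y => (b y * b y) * f y) (c p).
  exact: differentiableM.
rewrite /dirderiv (near_eq_diff H dbf) -deriveE //.
rewrite deriveM; [|exact: diff_derivable..].
rewrite deriveM; [|exact: diff_derivable..].
rewrite db b1 !scaler0 addr0 scaler0 addr0 mulr1 scale1r.
by apply: derive_pairing_cst; exact: diff_derivable.
Qed.

Lemma koszul u v w : pairing (g p) (nabla (X u) (X v) p) w =
  christoffel (chart_form c g) (c p) u v w.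
Proof.
pose N a b := nabla (X a) (X b) p.
have symN a a' : N a a' = N a' a.
  apply/eqP; rewrite -subr_eq0; apply/eqP.
  by rewrite /N (lc_torsion_free hn) // frame_bracket.
have E a a' a'' : pairing ('D_a (chart_form c g) (c p)) a' a'' =
    pairing (g p) (N a a') a'' + pairing (g p) (N a a'') a'.
  rewrite -{1}(frame_at a) -frame_derive; last exact: metric_smooth hg.
  by rewrite (lc_metric hn) // !frame_at (Defs.metric_sym hg p a').
(* With all brackets zero at p, the unknowns are x = g(N u v, w), y = g(N u w, v) and z = g(N v w,
   u), and metric compatibility gives three linear equations for them. *)
have alg (P Q S x y z : R) : P = x + y -> Q = x + z -> S = y + z ->
    x = (P + Q - S) / 2 by move=> -> -> ->; field.
have E2 := E v u w; have E3 := E w u v.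
rewrite (symN v u) in E2; rewrite (symN w u) (symN w v) in E3.
exact: alg (E u v w) E2 E3.
Qed.

(* By metric compatibility only the scalars g(A u, w) get differentiated: A
   itself, and the field A X, need not be expanded in coordinates. *)
Lemma cov_endo_chart (A : M -> 'M[R]_m) u w : smooth_endo A ->
  (forall a a', pairing (g p) (a *m A p) a' = - pairing (g p) a (a' *m A p)) ->
  pairing (g p) (cov_endo nabla A (X u) (X u) p) w =
    pairing ('D_u (chart_form c (fun q => A q *m g q)) (c p)) u w
    - christoffel (chart_form c g) (c p) u w (u *m A p)
    + christoffel (chart_form c g) (c p) u u (w *m A p).
Proof.
move=> sA skewA; rewrite -!koszul.
have sAX : smooth_vf (fun q => X u q *m A q) by exact: smooth_vf_endo.
have := lc_metric hn (sX u) sAX (sX w) p.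
have -> : (fun q => pairing (g q) (X u q *m A q) (X w q)) =
    (fun q => pairing (A q *m g q) (X u q) (X w q)).
  by apply/funext => q; rewrite /pairing mulmxA.
rewrite frame_derive; last exact: smooth_bilin_endo sA (metric_smooth hg).
rewrite !frame_at => ->; rewrite /cov_endo pairingDl pairingNl skewA opprK.
by rewrite (Defs.metric_sym hg p (nabla _ (X w) p)) addrK.
Qed.

End LeviCivita.

(** * Hypersurfaces *)

Section SecondFundamentalForm.
Context {R : realType}.

Lemma pairingDm m (A B : 'M[R]_m) u v :
  pairing (A + B) u v = pairing A u v + pairing B u v.
Proof. by rewrite /pairing mulmxDr mulmxDl mxE. Qed.

Lemma pairingZm m a (B : 'M[R]_m) u v :
  pairing (a *: B) u v = a * pairing B u v.
Proof. by rewrite /pairing -scalemxAr -scalemxAl mxE. Qed.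

(** The differential is linear in the direction, so additivity and homogeneity of the symbol can be
    read off from this form. *)
Lemma christoffel_diffE k (B : 'rV[R]_k -> 'M[R]_k) y a b c :
  differentiable B y -> christoffel B y a b c =
  (pairing ('d B y a) b c + pairing ('d B y b) a c - pairing ('d B y c) a b) / 2.
Proof.
move=> dB; have E z u v : pairing ('D_z B y) u v = pairing ('d B y z) u v.
  by rewrite deriveE.
have congr_christoffel (P P' Q Q' S S' : R) : P = P' -> Q = Q' -> S = S' ->
  (P + Q - S) / 2 = (P' + Q' - S') / 2 by move=> -> -> ->.
exact: congr_christoffel (E a b c) (E b a c) (E c a b).
Qed.

Lemma christoffelDl k (B : 'rV[R]_k -> 'M[R]_k) y a a' b c :
  differentiable B y -> christoffel B y (a + a') b c =
  christoffel B y a b c + christoffel B y a' b c.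
Proof.
move=> dB; rewrite !christoffel_diffE //; move: ('d B y) => L.
by rewrite linearD pairingDm !pairingDl; field.
Qed.

Lemma christoffelDr k (B : 'rV[R]_k -> 'M[R]_k) y a b c c' :
  differentiable B y -> christoffel B y a b (c + c') =
  christoffel B y a b c + christoffel B y a b c'.
Proof.
move=> dB; rewrite !christoffel_diffE //; move: ('d B y) => L.
by rewrite linearD pairingDm !pairingDr; field.
Qed.

Lemma christoffelZr k (B : 'rV[R]_k -> 'M[R]_k) y a b s c :
  differentiable B y -> christoffel B y a b (s *: c) =
  s * christoffel B y a b c.
Proof.
move=> dB; rewrite !christoffel_diffE //; move: ('d B y) => L.
by rewrite linearZ pairingZm !pairingZr; field.
Qed.

Lemma christoffelC k (B : 'rV[R]_k -> 'M[R]_k) y a b c :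
  differentiable B y ->
  (forall z a b, pairing (B z) a b = pairing (B z) b a) ->
  christoffel B y a b c = christoffel B y b a c.
Proof.
move=> dB symB; have S : pairing ('D_c B y) a b = pairing ('D_c B y) b a.
  have dc : derivable B y c by exact: diff_derivable.
  rewrite -(derive_pairing_cst a b dc) -(derive_pairing_cst b a dc).
  by under eq_fun do rewrite symB.
have alg (s t r r' : R) : r = r' -> (s + t - r) / 2 = (t + s - r') / 2.
  by move=> ->; rewrite (addrC s).
exact: alg S.
Qed.

(** The last hypothesis, the ambient nearly Kaehler condition on tangent vectors, is solved for d.
    Splitting each J f(v) into its tangential and normal parts then cancels the tangential
    Christoffel terms and, J being skew, the tangential terms in [H]. Only products with [nu]
    remain. *)
Lemma second_form_algebra m k (C : 'rV[R]_k -> 'rV[R]_k -> 'rV[R]_k -> R)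
    (B J : 'M[R]_k) (f : 'rV[R]_m -> 'rV[R]_k) (H : 'rV[R]_m -> 'rV[R]_m -> 'rV[R]_k)
    (phi : 'M[R]_m) (eta : 'cV[R]_m) (nu : 'rV[R]_k) (d : R) u w :
  (forall a b, pairing B a b = pairing B b a) ->
  (forall a b, pairing B (a *m J) b = - pairing B a (b *m J)) ->
  (forall a b c c', C a b (c + c') = C a b c + C a b c') ->
  (forall a b s c, C a b (s *: c) = s * C a b c) ->
  (forall v, f v *m J = f (v *m phi) + ev eta v *: nu) ->
  d - C (f u) (f w) (f u *m J) + C (f u) (f u) (f w *m J) = 0 ->
  (d + pairing B (H u u *m J) (f w) + pairing B (f u *m J) (H u w))
    - (C (f u) (f w) (f (u *m phi)) + pairing B (H u w) (f (u *m phi)))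
    + (C (f u) (f u) (f (w *m phi)) + pairing B (H u u) (f (w *m phi))) =
  ev eta u * (C (f u) (f w) nu + pairing B (H u w) nu)
    - ev eta w * (C (f u) (f u) nu + pairing B (H u u) nu).
Proof.
move=> symB skewJ CD CZ fJ; rewrite skewJ !fJ !CD !CZ => /eqP.
rewrite pairingDl pairingDr pairingZl pairingZr.
rewrite (symB (f _)) (symB nu) !addrA addr_eq0 => /eqP E.
have {E} -> : d = C (f u) (f w) (f (u *m phi)) + ev eta u * C (f u) (f w) nu
    - C (f u) (f u) (f (w *m phi)) - ev eta w * C (f u) (f u) nu.
  by lra.
by ring.
Qed.

Context {m k : nat}.
Variables (U : set 'rV[R]_m) (F : 'rV[R]_m -> 'rV[R]_k) (x : 'rV[R]_m).
Hypotheses (oU : open U) (sF : smooth_on U F) (Ux : U x).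
Variables (H : 'rV[R]_m -> 'rV[R]_m -> 'rV[R]_k).
Hypothesis (FH : forall a b, 'D_a ('D_b F) x = H a b).
Variables (g om : 'rV[R]_m -> 'M[R]_m) (G Om : 'rV[R]_k -> 'M[R]_k).
Hypotheses (dg : differentiable g x) (dG : differentiable G (F x))
  (dom : differentiable om x) (dOm : differentiable Om (F x)).
Hypotheses (symG : forall y a b, pairing (G y) a b = pairing (G y) b a)
  (gG : forall y, U y -> forall u v,
     pairing (g y) u v = pairing (G (F y)) ('D_u F y) ('D_v F y))
  (omOm : forall y, U y -> forall u v,
     pairing (om y) u v = pairing (Om (F y)) ('D_u F y) ('D_v F y)).
Variable nu : 'rV[R]_k.

(* h(u, w) = G(nabla_u w, nu), where F'' (u, w) + Gamma(F' u, F' w) is the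
   ambient covariant derivative and H stands for F''. *)
Definition second_form u w :=
  christoffel G (F x) ('D_u F x) ('D_w F x) nu + pairing (G (F x)) (H u w) nu.

Let symH a b : H a b = H b a.
Proof. by rewrite -FH -[RHS]FH; exact: derive_rVC oU sF Ux. Qed.

Lemma second_formC u w : second_form u w = second_form w u.
Proof.
rewrite /second_form (symH w u); apply: (congr1 (+%R^~ _)).
exact: christoffelC dG symG.
Qed.

Lemma second_formDl u u' w :
  second_form (u + u') w = second_form u w + second_form u' w.
Proof.
have dF : differentiable F x by exact: smooth_on_differentiable Ux.
have dDF : differentiable ('D_w F) x.
  exact: smooth_on_differentiable (smooth_on_derive w sF) Ux.
have E : 'D_(u + u') F x = 'D_u F x + 'D_u' F x.
  by apply: etrans (deriveE _ dF) _; rewrite linearD; congr (_ + _); rewrite deriveE.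
have EH : H (u + u') w = H u w + H u' w.
  rewrite -(FH u) -(FH u'); apply: etrans (esym (FH _ _)) _.
  by apply: etrans (deriveE _ dDF) _; rewrite linearD; congr (_ + _); rewrite deriveE.
rewrite /second_form EH pairingDl E christoffelDl //.
by rewrite addrACA.
Qed.

(** By [cov_endo_chart] the left-hand side is g((nabla_u phi) u, w), and the last hypothesis is the
    nearly Kaehler condition for equal fields. *)
Lemma second_form_identity (J : 'M[R]_k) (phi : 'M[R]_m) (eta : 'cV[R]_m) u w :
  (forall v, 'D_v F x *m J = 'D_(v *m phi) F x + ev eta v *: nu) ->
  (forall a b, pairing (Om (F x)) a b = pairing (G (F x)) (a *m J) b) ->
  (forall a b, pairing (G (F x)) (a *m J) b = - pairing (G (F x)) a (b *m J)) ->
  (forall a b, pairing ('D_a Om (F x)) a b - christoffel G (F x) a b (a *m J)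
     + christoffel G (F x) a a (b *m J) = 0) ->
  pairing ('D_u om x) u w - christoffel g x u w (u *m phi)
    + christoffel g x u u (w *m phi) =
  ev eta u * second_form u w - ev eta w * second_form u u.
Proof.
move=> FJ OmJ skewJ nK.
have gauss z v := christoffel_pullback oU sF Ux FH u v z dg dG (symG (F x)) gG.
have D := derive_pullback oU sF Ux FH u w u dom dOm omOm.
rewrite !OmJ in D.
have subst (P P' Q Q' S S' T : R) : P = P' -> Q = Q' -> S = S' ->
  P' - Q' + S' = T -> P - Q + S = T by move=> -> -> ->.
apply: (subst _ _ _ _ _ _ _ D (gauss (u *m phi) w) (gauss (w *m phi) u)).
apply: (second_form_algebra (C := christoffel G (F x))
  (f := fun v => 'D_v F x)) => // [a b c c'|a b s c].
- exact: christoffelDr.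
- exact: christoffelZr.
Qed.

End SecondFundamentalForm.

(** * Pulling back forms along the inclusion, in charts *)

Section Pullback.
Context {R : realType} {m k : nat} {M : manifold R m} {N : manifold R k}.
Variable iota : M -> N.
Hypothesis (si : smooth_map iota).
Variables (c : chart R m M) (d : chart R k N).
Hypotheses (ac : atlas c) (ad : atlas d).

Let F := d \o iota \o chart_inv c.
Let U := c @` (chart_dom c `&` iota @^-1` chart_dom d).

Lemma open_pullback_dom : open U.
Proof.
apply: open_chart_image; move/continuousP: si.1; apply.
exact: chart_dom_open.
Qed.

Lemma pullback_smooth : smooth_on U F.
Proof. exact: si.2. Qed.

(** Both sides are the differential at c q of iota read from c to the preferred chart at iota q,
    factored once through the preferred chart at q and once through d. *)
Lemma differential_of_coords q v : chart_dom c q -> chart_dom d (iota q) ->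
  differential iota q (of_coords c (c q) v) =
  of_coords d (d (iota q)) ('D_v F (c q)).
Proof.
move=> cq dq; rewrite !of_coordsE // /differential.
have [aq aiq] := (chart_at_atlas q, chart_at_atlas (iota q)).
have [qq iqq] := (chart_at_dom q, chart_at_dom (iota q)).
have oi (O : set N) : open O -> open (iota @^-1` O) by move/continuousP: si.1; apply.
have dsm c' d' (ac' : atlas c') (ad' : atlas d') : chart_dom c' q ->
    chart_dom d' (iota q) -> differentiable (d' \o iota \o chart_inv c') (c' q).
  move=> c'q d'q; apply: smooth_on_differentiable (si.2 c' d' ac' ad') _.
  by exists q.
have H1 : \forall y \near c q, (chart_at (iota q) \o iota \o
    chart_inv (chart_at q)) ((chart_at q \o chart_inv c) y) =
    (chart_at (iota q) \o iota \o chart_inv c) y.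
  have := near_chart_image (chart_dom_open (chart_at q)) cq qq.
  by apply: filterS => y [_ dy]; rewrite /= chart_mapK.
have H2 : \forall y \near c q, (chart_at (iota q) \o chart_inv d) (F y) =
    (chart_at (iota q) \o iota \o chart_inv c) y.
  have := near_chart_image (oi _ (chart_dom_open d)) cq dq.
  by apply: filterS => y [_ dy]; rewrite /F /= chart_mapK.
have dF : differentiable F (c q) by exact: dsm.
have E1 : (chart_at q \o chart_inv c) (c q) = chart_at q q.
  by rewrite /= chart_mapK.
have E2 : F (c q) = d (iota q) by rewrite /F /= chart_mapK.
have T1 := transition_differentiable ac aq cq qq.
have T2 := transition_differentiable ad aiq dq iqq.
rewrite (deriveE v dF).
exact: etrans (esym (chain_rule v E1 T1 (dsm _ _ aq aiq qq iqq) H1).2)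
  (chain_rule v E2 dF T2 H2).2.
Qed.

Lemma chart_form_pullback (B : M -> 'M[R]_m) (C : N -> 'M[R]_k) :
  (forall q u v, pairing (B q) u v =
     pairing (C (iota q)) (differential iota q u) (differential iota q v)) ->
  forall y, U y -> forall u v,
  pairing (chart_form c B y) u v =
  pairing (chart_form d C (F y)) ('D_u F y) ('D_v F y).
Proof.
move=> BC _ [q [cq dq] <-] u v.
have E : F (c q) = d (iota q) by rewrite /F /= chart_mapK.
apply: etrans (pairing_chart_form c B _ u v) _.
apply: etrans _ (esym (pairing_chart_form d C _ _ _)).
rewrite E !chart_mapK // BC.
have cong a a' b b' : a = a' -> b = b' ->
  pairing (C (iota q)) a b = pairing (C (iota q)) a' b' by move=> -> ->.
by apply: cong; exact: differential_of_coords.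
Qed.

End Pullback.

(** * The contradiction at a single point of the hypersurface *)

Lemma evD (R : realType) m (a : 'cV[R]_m) u v : ev a (u + v) = ev a u + ev a v.
Proof. by rewrite /ev mulmxDl mxE. Qed.

Lemma ev_kernel (R : realType) m (a : 'cV[R]_m) : (1 < m)%N ->
  exists2 u : 'rV[R]_m, u != 0 & ev a u = 0.
Proof.
move=> m1; exists (nz_row (kermx a)).
  rewrite nz_row_eq0 -mxrank_eq0 mxrank_ker subn_eq0 -ltnNge.
  exact: leq_ltn_trans (rank_leq_col a) m1.
by rewrite /ev (sub_kermxP (nz_row_sub _)) mxE.
Qed.

Theorem theorem4 (R : realType) (n : nat) (hn : (1 <= n)%N)
    (N : manifold R (2 * n).+2) (J G : N -> 'M[R]_((2 * n).+2))
    (hN : nearly_kahler J G)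
    (M : manifold R (2 * n).+1) (iota : M -> N) (g : M -> 'M[R]_((2 * n).+1))
    (hM : riemannian_hypersurface iota g G)
    (nu : M -> 'rV[R]_((2 * n).+2)) (hnu : unit_normal iota G nu)
    (phi : M -> 'M[R]_((2 * n).+1)) (xi : M -> 'rV[R]_((2 * n).+1))
    (eta : M -> 'cV[R]_((2 * n).+1))
    (hind : induced_structure iota J nu phi xi eta) :
  ~ nearly_kenmotsu phi xi eta g.
Proof.
move=> [hacm [nablaM hlcM hK]].
have [hah [nablaN hlcN hNK]] := hN.
have [hJ hJnu] := hind.
have [p _] := manifold_nonempty M.
have hg := acm_metric hacm; have hG := ah_metric hah.
have symG := Defs.metric_sym hG.
have skewJ q a b : pairing (G q) (a *m J q) b = - pairing (G q) a (b *m J q).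
  by rewrite -(ah_compat hah) (ah_J2 hah) pairingNl.
have omE k (A B : 'M[R]_k) a b : pairing (A *m B) a b = pairing B (a *m A) b.
  by rewrite /pairing mulmxA.
have gG := hyp_metric hM.
have nuN q v : pairing (G (iota q)) (differential iota q v) (nu q) = 0.
  by rewrite symG (normal_orth hnu).
have phiJ q a b : pairing (g q) (a *m phi q) b =
    pairing (G (iota q)) (differential iota q a *m J (iota q)) (differential iota q b).
  by rewrite gG hJ pairingDl pairingZl (normal_orth hnu) mulr0 addr0.
have skewphi q a b : pairing (g q) (a *m phi q) b = - pairing (g q) a (b *m phi q).
  by rewrite phiJ skewJ hJ pairingDr pairingZr nuN mulr0 addr0 -gG.
have omOm q u v : pairing (phi q *m g q) u v = pairing (J (iota q) *m G (iota q))
    (differential iota q u) (differential iota q v).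
  by rewrite !omE phiJ.
have si := hyp_smooth hM.
pose c := chart_at p; pose d := chart_at (iota p).
have [ac ad] : atlas c /\ atlas d by split; exact: chart_at_atlas.
have [cp dp] : chart_dom c p /\ chart_dom d (iota p) by split; exact: chart_at_dom.
have [X [b [sX sb b1 db Xb]]] := local_frame p.
have [Y [b' [sY sb' b1' db' Yb]]] := local_frame (iota p).
set F := d \o iota \o chart_inv c.
set U := c @` (chart_dom c `&` iota @^-1` chart_dom d).
have Ux : U (c p) by exists p.
have oU : open U by exact: open_pullback_dom.
have sF : smooth_on U F := pullback_smooth si ac ad.
have Fx : F (c p) = d (iota p) by rewrite /F /= chart_mapK.
have DF v : 'D_v F (c p) = differential iota p v.
  rewrite /differential deriveE //; exact: smooth_on_differentiable sF Ux.
(* The existential turns F'' at the base point into an opaque symbol. *)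
have [H FH] : exists H, forall u v, 'D_u ('D_v F) (c p) = H u v.
  by exists (fun u v => 'D_u ('D_v F) (c p)).
have sg := metric_smooth hg; have sG := metric_smooth hG.
have som := smooth_bilin_endo (acm_phi_smooth hacm) sg.
have sOm := smooth_bilin_endo (ah_J_smooth hah) sG.
pose gc := chart_form c g; pose Gd := chart_form d G.
pose omc := chart_form c (fun q => phi q *m g q).
pose Omd := chart_form d (fun q => J q *m G q).
have dgc : differentiable gc (c p) by exact: chart_form_differentiable.
have domc : differentiable omc (c p) by exact: chart_form_differentiable.
have dGd : differentiable Gd (F (c p)).
  by rewrite Fx; exact: chart_form_differentiable.
have dOmd : differentiable Omd (F (c p)).
  by rewrite Fx; exact: chart_form_differentiable.
have symGd y u v : pairing (Gd y) u v = pairing (Gd y) v u.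
  by rewrite !pairing_chart_form symG.
have gGd := chart_form_pullback si ac ad gG.
have omOmd := chart_form_pullback (C := fun q => J q *m G q) si ac ad omOm.
have GdE B u v : pairing (chart_form d B (F (c p))) u v = pairing (B (iota p)) u v.
  by rewrite Fx pairing_chart_form chart_mapK // !of_coords_chart_at.
pose h := second_form F (c p) H Gd (nu p).
have hC u w : h u w = h w u.
  by have := second_formC oU sF Ux FH dGd symGd (nu p) u w; exact.
have hD u u' w : h (u + u') w = h u w + h u' w.
  by have := second_formDl sF Ux FH dGd (nu p) u u' w; exact.
(* For equal fields the nearly Kaehler condition says that twice (nabla_u J) u is 0;
   [cov_endo_chart] reads this in the chart d. *)
have nK u w : pairing ('D_u Omd (F (c p))) u w
    - christoffel Gd (F (c p)) u w (u *m J (iota p))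
    + christoffel Gd (F (c p)) u u (w *m J (iota p)) = 0.
  rewrite Fx.
  apply: etrans (esym (cov_endo_chart hG hlcN sY sb' b1' db' Yb u w
    (ah_J_smooth hah) (skewJ (iota p)))) _.
  have /eqP := hNK (Y u) (Y u) (sY u) (sY u) (iota p).
  rewrite -mulr2n -scaler_nat scaler_eq0 pnatr_eq0 /= => /eqP ->.
  exact: pairing0l.
pose e := ev (eta p).
(* The two expressions for g((nabla_u phi) u, w) are equated: the one from the hypersurface and,
   after halving, the one from the nearly Kenmotsu condition. *)
have star u w : e u * h u w - e w * h u u = - (e u * pairing (g p) (u *m phi p) w).
  have FJ v : 'D_v F (c p) *m J (iota p) =
      'D_(v *m phi p) F (c p) + ev (eta p) v *: nu p by rewrite !DF hJ.
  have OmJ a a' : pairing (Omd (F (c p))) a a' =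
      pairing (Gd (F (c p))) (a *m J (iota p)) a' by rewrite !GdE omE.
  have skewJd a a' : pairing (Gd (F (c p))) (a *m J (iota p)) a' =
      - pairing (Gd (F (c p))) a (a' *m J (iota p)) by rewrite !GdE skewJ.
  apply: etrans (esym (second_form_identity oU sF Ux FH dgc dGd domc dOmd symGd
    gGd omOmd u w FJ OmJ skewJd nK)) _.
  apply: etrans (esym (cov_endo_chart hg hlcM sX sb b1 db Xb u w
    (acm_phi_smooth hacm) (skewphi p))) _.
  have := hK (X u) (X u) (sX u) (sX u) p.
  rewrite (frame_at b1 Xb) -opprD => E.
  rewrite -mulNr -pairingZl; congr (pairing _ _ _).
  apply: (@scalerI _ _ (2%:R : R)); first by rewrite pnatr_eq0.
  by rewrite !scaler_nat !mulr2n E opprD scaleNr.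
have exi : e (xi p) = 1 := acm_eta_xi hacm p.
(* Applying J to J nu = - xi' gives J xi' = nu, whereas the induced structure gives J xi' = (phi
   xi)' + nu. *)
have dxi0 : differential iota p (xi p *m phi p) = 0.
  have := hJ p (xi p); rewrite -/(e _) exi scale1r => E.
  have := congr1 (fun v => v *m J (iota p)) (hJnu p).
  rewrite (ah_J2 hah) mulNmx E => /oppr_inj /eqP.
  by rewrite eq_sym -subr_eq0 addrK => /eqP.
have gxi w : pairing (g p) (xi p *m phi p) w = 0 by rewrite gG dxi0 pairing0l.
have hxi w : h (xi p) w = e w * h (xi p) (xi p).
  by have := star (xi p) w; rewrite exi gxi !mul1r oppr0 => /eqP; rewrite subr_eq0 => /eqP.
have key u w : e u = 0 -> h u w = - pairing (g p) (u *m phi p) w.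
  move=> eu; have huu : h u u = 0.
    by have := star u (xi p); rewrite eu exi !mul0r mul1r; lra.
  (* The value h(xi, xi) is unknown, but it enters through h(xi, w) and through e(w) h(u + xi, u +
     xi) with opposite signs, and cancels. *)
  have := star (u + xi p) w.
  have -> : e (u + xi p) = 1 by rewrite /e evD -/(e _) -/(e _) eu exi add0r.
  rewrite mulmxDl pairingDl gxi !hD (hC u (u + _)) (hC (xi p) (u + _)) !hD.
  rewrite huu (hC u (xi p)) (hxi u) (hxi w) eu; lra.
(* Here (phi u)' = J u', so J maps it to the tangent vector - u'; the normal component e(phi u) of
   that image is therefore 0. *)
have ephi u : e u = 0 -> e (u *m phi p) = 0.
  move=> eu; have := hJ p (u *m phi p).
  have -> : differential iota p (u *m phi p) = differential iota p u *m J (iota p).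
    by rewrite hJ -/(e _) eu scale0r addr0.
  rewrite (ah_J2 hah) => /(congr1 (pairing (G (iota p)) (nu p))).
  rewrite pairingNr pairingDr pairingZr !(normal_orth hnu) (normal_unit hnu).
  by rewrite oppr0 add0r mulr1.
(* As n >= 1, the dimension 2n + 1 exceeds 1 and the kernel of eta is nonzero. *)
have [u u0 eu] : exists2 u, u != 0 & e u = 0.
  by apply: ev_kernel; rewrite ltnS muln_gt0.
have := metric_pos hg p u0.
(* [key] at (u, phi u) gives h(u, phi u) = - g(u, u), and at (phi u, u) it gives h(phi u, u) = g(u,
   u), since phi squared is - 1 on the kernel of eta. *)
have := key u (u *m phi p) eu; have := key _ u (ephi u eu).
rewrite (acm_phi2 hacm) (acm_compat hacm) -/(e u) eu scale0r addr0 pairingNl hC.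
lra.
Qed.
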